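(* Let $m>2$ and let $[\xi^{A'}]$ be a holomorphic projective pure spinor field on a $2m$-dimensional spin complex Riemannian manifold $(\mathcal M,g)$. Each of the conditions $$\text{(a)}\ (\xi^{a[A}\nabla_a\xi^{bB})\xi_b{}^{C]}=0,\qquad \text{(b)}\ (\xi^{a(A}\nabla_a\xi^{bB)})\xi_b{}^{C}=0,$$ $$\text{(c)}\ (\nabla_a\xi^{bB})\xi_b{}^{C}+\tfrac2{m-1}\big(\xi_a{}^{[B}\nabla_b\xi^{bC]}+\xi^{b[B}\nabla_b\xi_a{}^{C]}\big)=0\quad(m>3)$$ is conformally invariant. Suppose further (with $m>3$) that $[\xi^{A'}]$ satisfies (c) and $$\xi^{A'}\nabla_b\xi^{bB}-\xi^{bB}\nabla_b\xi^{A'}=-(m-1)\,\xi^{A'}\xi^{bB}\nabla_bf$$ for some holomorphic function $f$. Then there exists a holomorphic conformal rescaling of the metric such that $[\xi^{A'}]$ is parallel, i.e. such that, for the rescaled metric, $(\nabla_a\xi^{bB})\xi_b{}^{C}=0$, equivalently $(\nabla_a\xi^{[B'})\xi^{C']}=0$.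
   Context: $(\mathcal M,g)$ is a complex manifold of dimension $n=2m$ with a non-degenerate holomorphic section $g_{ab}$ of $\odot^2T^*\mathcal M$ (holomorphic metric), a holomorphic volume form and a holomorphic spin structure; $\nabla_a$ is its holomorphic Levi-Civita connection and the induced spin connection. All fields are holomorphic. $\mathcal S^\pm$ are the chiral spinor bundles; sections of $\mathcal S^+$ have primed upper indices and of $\mathcal S^-$ unprimed ones. Clifford multiplication is given by ($\nabla$-parallel) $\gamma_{aA'}{}^B$, $\gamma_{aA}{}^{B'}$ with $\gamma_{(a|A'}{}^{C}\gamma_{|b)C}{}^{B'}=-g_{ab}\delta_{A'}^{B'}$, $\gamma_{(a|A}{}^{C'}\gamma_{|b)C'}{}^{B}=-g_{ab}\delta_A^B$. Brackets denote normalised (skew-)symmetrisation. Put $\xi_a{}^A:=\xi^{B'}\gamma_{aB'}{}^A$. $\xi^{A'}$ is pure if it is nowhere zero and at every point the kernel of $\xi_a{}^A:T\mathcal M\to\mathcal S^-$ has dimension $m$; a projective pure spinor field $[\xi^{A'}]$ is a pure spinor field up to scale. The conditions in the claim do not depend on the scale of $\xi^{A'}$. A holomorphic conformal rescaling is $\hat g_{ab}=\Omega^2g_{ab}$ with $\Omega$ a non-vanishing holomorphic function. With $\Upsilon_a:=\Omega^{-1}\nabla_a\Omega$ one takes $\hat\gamma_{aA}{}^{B'}=\Omega\gamma_{aA}{}^{B'}$, $\hat\gamma_{aB'}{}^{A}=\Omega\gamma_{aB'}{}^{A}$, $\hat\xi_a{}^A:=\xi^{B'}\hat\gamma_{aB'}{}^A$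 (indices raised with $\hat g$), and the spin connection of $\hat g$ is $\hat\nabla_a\xi^{B'}=\nabla_a\xi^{B'}-\frac12\Upsilon_b\gamma^b{}_{C'}{}^{D}\gamma_{aD}{}^{B'}\xi^{C'}$. A condition is conformally invariant if it holds for $(g,\nabla,\gamma)$ if and only if it holds for $(\hat g,\hat\nabla,\hat\gamma)$. *)

(* Defs.v *)
From mathcomp Require Import all_boot all_order all_algebra.
From mathcomp Require Import complex.
From mathcomp Require Import all_classical all_reals topology normedtype derive.

Set Implicit Arguments.
Unset Strict Implicit.
Unset Printing Implicit Defensive.

Import Order.TTheory GRing.Theory Num.Theory.
Import numFieldNormedType.Exports.

Local Open Scope classical_set_scope.
Local Open Scope ring_scope.

(* The index conventions are: lower index = row, upper index = column.  So a
   spinor xi^{A'} (resp. zeta^A) is a row vector, an endomorphism acts on the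
   right, and xi^{B'} gamma_{aB'}^A is [xi *m gamma a].  Frames and tangent
   vectors are row vectors as well. *)

(* The field of complex numbers, packed as a numFieldType so that the topology
   and the norm of the library on the underlying type are inferred. *)
Definition CC (R : realType) : numFieldType := R[i].

Section Calculus.
Variable R : realType.
Local Notation C := (CC R).

(* Complex Frechet differentiability; at every point of an open set this is
   holomorphy on that set. *)
Definition holo n (f : 'rV[C]_n -> C) (x : 'rV[C]_n) : Prop :=
  differentiable f x.

Definition holo_mx n p q (F : 'rV[C]_n -> 'M[C]_(p, q)) (x : 'rV[C]_n) : Prop :=
  forall k l, holo (fun y => F y k l) x.

Definition pd n (a : 'I_n) (f : 'rV[C]_n -> C) (x : 'rV[C]_n) : C :=
  derive f x (delta_mx 0 a).

Definition pd_mx n p q (a : 'I_n) (F : 'rV[C]_n -> 'M[C]_(p, q))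
    (x : 'rV[C]_n) : 'M[C]_(p, q) :=
  \matrix_(k, l) pd a (fun y => F y k l) x.

(* Normalised (skew-)symmetrisations. *)
Definition skew2 I (T : I -> I -> C) (A B : I) : C :=
  2^-1 * (T A B - T B A).

Definition symm2 I (T : I -> I -> C) (A B : I) : C :=
  2^-1 * (T A B + T B A).

Definition skew3 I (T : I -> I -> I -> C) (A B D : I) : C :=
  6^-1 * (T A B D + T B D A + T D A B - T B A D - T A D B - T D B A).

End Calculus.

Record complex_manifold (R : realType) (n : nat) := ComplexManifold {
  carrier :> topologicalType;
  _ : hausdorff_space carrier;
  _ : second_countable (T := carrier);
  idx : Type;
  dom : idx -> set carrier;
  chart : idx -> carrier -> 'rV[CC R]_n;
  param : idx -> 'rV[CC R]_n -> carrier;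
  _ : forall p, exists i, dom i p;
  _ : forall i, open (dom i);
  _ : forall i, open (chart i @` dom i);
  _ : forall i p, dom i p -> param i (chart i p) = p;
  _ : forall i, {within dom i, continuous (chart i)};
  _ : forall i, {within chart i @` dom i, continuous (param i)};
  _ : forall i j p, dom i p -> dom j p ->
        holo_mx (fun x => chart j (param i x)) (chart i p)
}.

Section Manifold.
Variables (R : realType) (n : nat) (M : complex_manifold R n).
Local Notation C := (CC R).

Definition cdom (i : idx M) : set 'rV[C]_n := chart i @` dom i.

(* Row vectors push forward from chart i to chart j by [v |-> v *m jac i j p]. *)
Definition jac (i j : idx M) (p : M) : 'M[C]_n :=
  \matrix_(a, b) pd a (fun x => chart j (param i x) 0 b) (chart i p).

Definition holo_on_manifold (f : M -> C) : Prop :=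
  forall i x, cdom i x -> holo (f \o param i) x.

Definition conformal_factor (Om : M -> C) : Prop :=
  holo_on_manifold Om /\ forall p, Om p != 0.

End Manifold.

Section Clifford.
Variables (R : realType) (m : nat).
Local Notation C := (CC R).

(* Constant gamma matrices of the standard quadratic form of C^(2m), on chiral
   spinor spaces of dimension 2^(m-1): S^+ and S^- are then the two half-spin
   modules ([cgp] maps S^+ to S^-, [cgm] maps S^- to S^+). *)
Record clifford_module := CliffordModule {
  cgp : 'I_(2 * m) -> 'M[C]_(2 ^ m.-1);
  cgm : 'I_(2 * m) -> 'M[C]_(2 ^ m.-1);
  _ : forall k l, 2^-1 *: (cgp k *m cgm l + cgp l *m cgm k) =
        (- (k == l)%:R)%:M;
  _ : forall k l, 2^-1 *: (cgm k *m cgp l + cgm l *m cgp k) =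
        (- (k == l)%:R)%:M
}.

Definition cmul (g : 'I_(2 * m) -> 'M[C]_(2 ^ m.-1)) (u : 'rV[C]_(2 * m)) :=
  \sum_k u 0 k *: g k.

Definition hrefl (u : 'rV[C]_(2 * m)) : 'M[C]_(2 * m) :=
  1%:M - 2 *: (u^T *m u).

(* [spin_elt S P Q L]: P and Q are the actions on S^+ and S^- of an element of
   Spin(2m,C), i.e. of a product of an even number of unit vectors, and L is
   its image in SO(2m,C); for every w one has
   [cmul cgp w *m Q = P *m cmul cgp (w *m L)]. *)
Inductive spin_elt (S : clifford_module) :
    'M[C]_(2 ^ m.-1) -> 'M[C]_(2 ^ m.-1) -> 'M[C]_(2 * m) -> Prop :=
| spin_elt1 : spin_elt S 1%:M 1%:M 1%:M
| spin_eltM P Q L (u v : 'rV[C]_(2 * m)) :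
    spin_elt S P Q L -> u *m u^T = 1%:M -> v *m v^T = 1%:M ->
    spin_elt S (P *m (cmul (cgp S) u *m cmul (cgm S) v))
               (Q *m (cmul (cgm S) u *m cmul (cgp S) v))
               (L *m (hrefl u *m hrefl v)).

End Clifford.

(* A complex Riemannian spin manifold: the spin structure is given, over the
   charts, by holomorphic orthonormal frames (the k-th frame vector is the k-th
   row) whose SO(2m,C)-valued transition functions are lifted to a holomorphic
   Spin(2m,C)-valued cocycle.  As the frames are related by SO(2m,C), the
   volume form of the dual frames is globally defined.  Over chart i the
   bundles S^+ and S^- are trivialised so that a section of S^+ has
   representatives related by [xi j = xi i *m liftp i j]. *)
Record spin_manifold (R : realType) (m : nat) (S : clifford_module R m) :=
  SpinManifold {
  base :> complex_manifold R (2 * m);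
  metric : idx base -> 'rV[CC R]_(2 * m) -> 'M[CC R]_(2 * m);
  _ : forall i x, cdom i x -> holo_mx (metric i) x;
  _ : forall i x, cdom i x -> (metric i x)^T = metric i x;
  _ : forall i x, cdom i x -> metric i x \in unitmx;
  _ : forall i j p, dom i p -> dom j p ->
        metric i (chart i p) =
        jac i j p *m metric j (chart j p) *m (jac i j p)^T;
  frame : idx base -> 'rV[CC R]_(2 * m) -> 'M[CC R]_(2 * m);
  _ : forall i x, cdom i x -> holo_mx (frame i) x;
  _ : forall i x, cdom i x -> frame i x *m metric i x *m (frame i x)^T = 1%:M;
  liftp : idx base -> idx base -> base -> 'M[CC R]_(2 ^ m.-1);
  liftm : idx base -> idx base -> base -> 'M[CC R]_(2 ^ m.-1);
  _ : forall i j p, dom i p -> dom j p ->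
        holo_mx (liftp i j \o param i) (chart i p) /\
        holo_mx (liftm i j \o param i) (chart i p);
  _ : forall i j p, dom i p -> dom j p ->
        exists2 L, spin_elt S (liftp i j p) (liftm i j p) L &
                   frame i (chart i p) *m jac i j p = L *m frame j (chart j p);
  _ : forall i j k p, dom i p -> dom j p -> dom k p ->
        liftp i j p *m liftp j k p = liftp i k p /\
        liftm i j p *m liftm j k p = liftm i k p
}.

(* The local expression of (g, gamma, nabla) in a chart of dimension n, with
   spinors of rank N: [gamp a] is gamma_{aA'}^B and [gamm a] is gamma_{aA}^{B'};
   the covariant derivatives of sections of S^+ and S^- are
   [pd_mx a xi x + xi x *m conp a x] and [pd_mx a zeta x + zeta x *m conm a x]. *)
Record spin_geometry (R : realType) (n N : nat) := SpinGeometry {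
  met : 'rV[CC R]_n -> 'M[CC R]_n;
  gamp : 'I_n -> 'rV[CC R]_n -> 'M[CC R]_N;
  gamm : 'I_n -> 'rV[CC R]_n -> 'M[CC R]_N;
  conp : 'I_n -> 'rV[CC R]_n -> 'M[CC R]_N;
  conm : 'I_n -> 'rV[CC R]_n -> 'M[CC R]_N
}.

(* Gamma^b_{ac} of the Levi-Civita connection. *)
Definition christoffel (R : realType) n (g : 'rV[CC R]_n -> 'M[CC R]_n)
    (b a c : 'I_n) (x : 'rV[CC R]_n) : CC R :=
  2^-1 * \sum_d invmx (g x) b d *
    (pd a (fun y => g y c d) x + pd c (fun y => g y a d) x
     - pd d (fun y => g y a c) x).

Section InducedGeometry.
Variables (R : realType) (m : nat) (S : clifford_module R m).
Variables (X : spin_manifold S) (i : idx X).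
Local Notation C := (CC R).
Local Notation n := (2 * m)%N.
Local Notation g := (metric i).
Local Notation e := (frame i).

(* omega_{akl} = g(nabla_a e_k, e_l). *)
Definition spin_omega (a k l : 'I_n) (x : 'rV[C]_n) : C :=
  \sum_b \sum_c
    (pd a (fun y => e y k b) x + \sum_d christoffel g b a d x * e x k d)
    * g x b c * e x l c.

(* gamma_a = g_{ab} e_k^b gamma_k.  The coefficient -1/4 is the one for which
   the Clifford relation gamma_(k gamma_l) = - delta_kl makes gamma_a parallel. *)
Definition induced_geometry : spin_geometry R n (2 ^ m.-1) := {|
  met := g;
  gamp := fun a x => \sum_k (g x *m (e x)^T) a k *: cgp S k;
  gamm := fun a x => \sum_k (g x *m (e x)^T) a k *: cgm S k;
  conp := fun a x => - 4^-1 *: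
    \sum_k \sum_l spin_omega a k l x *: (cgp S k *m cgm S l);
  conm := fun a x => - 4^-1 *:
    \sum_k \sum_l spin_omega a k l x *: (cgm S k *m cgp S l)
|}.

End InducedGeometry.

Section LocalGeometry.
Variables (R : realType) (n N : nat).
Local Notation C := (CC R).

(* gamma^b = g^{bc} gamma_c *)
Definition gamp_up (G : spin_geometry R n N) (b : 'I_n) (x : 'rV[C]_n) : 'M[C]_N :=
  \sum_c invmx (met G x) b c *: gamp G c x.

Definition gamm_up (G : spin_geometry R n N) (b : 'I_n) (x : 'rV[C]_n) : 'M[C]_N :=
  \sum_c invmx (met G x) b c *: gamm G c x.

(* The rescaling by Om: the metric is Om^2 g, the gamma_a are multiplied by Om,
   and the spin connections are modified by - 1/2 Upsilon_b gamma^b gamma_a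
   (gamma^b acting first).  The formula on S^- is the analogue of the one on
   S^+; it is the one for which the rescaled gamma_a are again parallel. *)
Definition conformal (Om : 'rV[C]_n -> C) (G : spin_geometry R n N) :
    spin_geometry R n N :=
  let Ups b x := (Om x)^-1 * pd b Om x in {|
  met := fun x => Om x ^+ 2 *: met G x;
  gamp := fun a x => Om x *: gamp G a x;
  gamm := fun a x => Om x *: gamm G a x;
  conp := fun a x => conp G a x -
    2^-1 *: \sum_b Ups b x *: (gamp_up G b x *m gamm G a x);
  conm := fun a x => conm G a x -
    2^-1 *: \sum_b Ups b x *: (gamm_up G b x *m gamp G a x)
|}.

Section SpinorField.
Variables (G : spin_geometry R n N) (xi : 'rV[C]_n -> 'rV[C]_N).

(* nabla_a xi^{A'} *)
Definition nabla_xi (a : 'I_n) (x : 'rV[C]_n) : 'rV[C]_N :=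
  pd_mx a xi x + xi x *m conp G a x.

(* xi_a^A *)
Definition xi_low (a : 'I_n) (x : 'rV[C]_n) : 'rV[C]_N := xi x *m gamp G a x.

(* xi^{aA} *)
Definition xi_up (a : 'I_n) (x : 'rV[C]_n) : 'rV[C]_N :=
  \sum_b invmx (met G x) a b *: xi_low b x.

(* nabla_a xi_b^B *)
Definition nabla_xi_low (a b : 'I_n) (x : 'rV[C]_n) : 'rV[C]_N :=
  pd_mx a (xi_low b) x - \sum_c christoffel (met G) c a b x *: xi_low c x
  + xi_low b x *m conm G a x.

(* nabla_a xi^{bB} *)
Definition nabla_xi_up (a b : 'I_n) (x : 'rV[C]_n) : 'rV[C]_N :=
  pd_mx a (xi_up b) x + \sum_c christoffel (met G) b a c x *: xi_up c x
  + xi_up b x *m conm G a x.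

(* The kernel of xi_a^A : T M -> S^- has dimension m. *)
Definition pure_at (m : nat) (x : 'rV[C]_n) : Prop :=
  \rank (kermx (\matrix_(a < n) xi_low a x)) = m.

(* (nabla_a xi^{bB}) xi_b^C *)
Definition nabla_xi_xi (a : 'I_n) (x : 'rV[C]_n) (B D : 'I_N) : C :=
  \sum_b nabla_xi_up a b x 0 B * xi_low b x 0 D.

(* (xi^{aA} nabla_a xi^{bB}) xi_b^C *)
Definition xi_nabla_xi_xi (x : 'rV[C]_n) (A B D : 'I_N) : C :=
  \sum_a xi_up a x 0 A * nabla_xi_xi a x B D.

(* nabla_b xi^{bB} *)
Definition div_xi (x : 'rV[C]_n) : 'rV[C]_N := \sum_b nabla_xi_up b b x.

Definition condition_a (x : 'rV[C]_n) : Prop :=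
  forall A B D, skew3 (xi_nabla_xi_xi x) A B D = 0.

Definition condition_b (x : 'rV[C]_n) : Prop :=
  forall A B D, symm2 (fun A' B' => xi_nabla_xi_xi x A' B' D) A B = 0.

Definition condition_c (m : nat) (x : 'rV[C]_n) : Prop :=
  forall a B D,
    nabla_xi_xi a x B D
    + 2 / (m%:R - 1) *
      (skew2 (fun B' D' => xi_low a x 0 B' * div_xi x 0 D') B D
       + skew2 (fun B' D' => \sum_b xi_up b x 0 B' * nabla_xi_low b a x 0 D') B D)
    = 0.

Definition condition_f (m : nat) (f : 'rV[C]_n -> C) (x : 'rV[C]_n) : Prop :=
  forall A B,
    xi x 0 A * div_xi x 0 B - \sum_b xi_up b x 0 B * nabla_xi b x 0 A
    = - (m%:R - 1) * (xi x 0 A * \sum_b xi_up b x 0 B * pd b f x).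

Definition parallel1 (x : 'rV[C]_n) : Prop :=
  forall a B D, nabla_xi_xi a x B D = 0.

Definition parallel2 (x : 'rV[C]_n) : Prop :=
  forall a B D, skew2 (fun B' D' => nabla_xi a x 0 B' * xi x 0 D') B D = 0.

End SpinorField.
End LocalGeometry.

(* A section of the projectivised S^+ is given by local representatives which
   agree up to scale. *)
Record projective_pure_spinor (R : realType) (m : nat) (S : clifford_module R m)
    (X : spin_manifold S) := ProjectivePureSpinor {
  rep :> idx X -> 'rV[CC R]_(2 * m) -> 'rV[CC R]_(2 ^ m.-1);
  _ : forall i x, cdom i x -> holo_mx (rep i) x;
  _ : forall i x, cdom i x -> rep i x != 0;
  _ : forall i x, cdom i x -> pure_at (induced_geometry i) (rep i) m x;
  _ : forall i j p, dom i p -> dom j p -> exists2 c : CC R, c != 0 &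
        rep j (chart j p) = c *: (rep i (chart i p) *m liftp i j p)
}.

Section Invariance.
Variables (R : realType) (m : nat) (S : clifford_module R m).
Variables (X : spin_manifold S) (xi : projective_pure_spinor X).
Local Notation C := (CC R).
Local Notation condition :=
  (spin_geometry R (2 * m) (2 ^ m.-1) ->
   ('rV[C]_(2 * m) -> 'rV[C]_(2 ^ m.-1)) -> 'rV[C]_(2 * m) -> Prop).

Definition holds (P : condition) : Prop :=
  forall i x, cdom i x -> P (induced_geometry i) (xi i) x.

Definition holds_rescaled (Om : X -> C) (P : condition) : Prop :=
  forall i x, cdom i x ->
    P (conformal (Om \o param i) (induced_geometry i)) (xi i) x.

Definition conformally_invariant (P : condition) : Prop :=
  forall Om : X -> C, conformal_factor Om -> (holds P <-> holds_rescaled Om P).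

Definition holds_f (f : X -> C) : Prop :=
  forall i x, cdom i x ->
    condition_f (induced_geometry i) (xi i) m (f \o param i) x.

End Invariance.

(* Main.v *)
Require Import Defs.
From mathcomp Require Import all_boot all_order all_algebra.
From mathcomp Require Import all_classical all_reals topology normedtype derive.
From mathcomp Require Import complex landau sequences exp trigo ring lra zify.

(* Write p_a = nabla_a xi, L_a = xi_a, U^a = xi^a.  As the gamma_a are parallel,
   nabla_a xi^b = p_a gamma^b, and the rescaling replaces p_a by
   p_a - 1/2 z gamma_a with z = Upsilon_c U^c.  Purity makes the kernel of xi_a
   its own orthogonal complement, hence U^b (x) L_b = 0; together with the
   Clifford relation this gives
     (z gamma_a gamma^b) (x) L_b = 2 (L_a (x) z - z (x) L_a),
   whose contraction with U^a vanishes: this is (a) and (b).  In (c) the change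
   is cancelled by those of the divergence (m z) and of U^b nabla_b L_a (z (x) L_a).
   For the last part take Omega = exp f: then Upsilon = df and the hypothesis on f
   says that, after rescaling, U^b nabla_b xi = (nabla_b U^b) xi, so the skew terms
   of (c) cancel and (nabla_a xi^b) xi_b = 0.  That this means nabla_a xi is a
   multiple of xi holds because the spinors killed by a maximal null subspace form
   a line: a projection onto them in S^+ (+) S^- has trace 1. *)
Set Implicit Arguments.
Unset Strict Implicit.
Unset Printing Implicit Defensive.

Import Order.TTheory GRing.Theory Num.Theory.
Import numFieldNormedType.Exports.

Local Open Scope classical_set_scope.
Local Open Scope ring_scope.

(** * Derivatives of matrix-valued functions *)

Section DirectionalDerivatives.
Variables (K : numFieldType) (V : normedModType K).
Implicit Types (f g : V -> K) (x v : V).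

Lemma diff_deriveM f g x v : differentiable f x -> differentiable g x ->
  'D_v (fun y => f y * g y) x = 'D_v f x * g x + f x * 'D_v g x.
Proof.
move=> hf hg.
have -> : (fun y => f y * g y) = (f * g : V -> K) by [].
rewrite deriveM; [|exact: diff_derivable..].
by rewrite addrC [g x *: _]mulrC.
Qed.

(** Near [x] the remainder of [g] with respect to ['d f x] is that of [f], so ['d f x] serves as the
    differential of [g] too; uniqueness of the differential does the rest. *)
Lemma near_eq_differentiable f g x :
  (\forall y \near x, f y = g y) -> differentiable f x -> differentiable g x.
Proof.
move=> fg /diff_locallyP [df ef].
have fgx : f x = g x by exact: (nbhs_singleton fg).
suff [dg eg] : continuous ('d f x) /\
    g \o shift x = cst (g x) + 'd f x +o_ (0 : V) id.
  apply/diff_locallyP; suff -> : 'd g x = 'd f x :> (V -> K) by [].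
  exact: diff_unique.
split=> //; apply/eqaddoP => e e0.
move/eqaddoP : ef => /(_ e e0) ef.
have {}fg : \forall y \near (0 : V), f (y + x) = g (y + x).
  by move: fg; rewrite (near_shift 0) /= subr0.
near=> y.
suff -> : (g \o shift x - (cst (g x) + 'd f x)) y =
    (f \o shift x - (cst (f x) + 'd f x)) y by near: y.
have -> : (g \o shift x - (cst (g x) + 'd f x)) y =
  g (y + x) - (g x + 'd f x y) by [].
by rewrite -fgx -(near fg y).
Unshelve. all: by end_near. Qed.

Lemma derive_comp_scale f (g : K -> K) (c : K) x v : differentiable f x ->
  is_diff (f x) g ( *:%R c) -> 'D_v (g \o f) x = c * 'D_v f x.
Proof.
move=> df [dg diff_g]; rewrite !deriveE //; last exact: differentiable_comp.
by rewrite diff_comp // diff_g.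
Qed.

Lemma diff_big_sum k (f : 'I_k -> V -> K) x :
  (forall l, differentiable (f l) x) -> differentiable (fun y => \sum_l f l y) x.
Proof.
move=> hf; have -> : (fun y => \sum_l f l y) = \sum_l f l.
  by apply/funext => y; rewrite fct_sumE.
exact: differentiable_sum.
Qed.

Lemma diff_derive_sum k (f : 'I_k -> V -> K) x v :
  (forall l, differentiable (f l) x) ->
  'D_v (fun y => \sum_l f l y) x = \sum_l 'D_v (f l) x.
Proof.
move=> hf; have -> : (fun y => \sum_l f l y) = \sum_l f l.
  by apply/funext => y; rewrite fct_sumE.
by rewrite derive_sum // => l; exact/diff_derivable/hf.
Qed.

End DirectionalDerivatives.

Section MatrixDerivatives.
Variables (K : numFieldType) (V : normedModType K).
Implicit Types (x v : V).

(** Over [CC R] this and [derive_mx] along [delta_mx 0 a] unfold to [holo_mx] and [pd_mx], so what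
    is proved here over any [numFieldType] applies to them by conversion. *)
Definition differentiable_mx p q (F : V -> 'M[K]_(p, q)) x :=
  forall k l, differentiable (fun y => F y k l) x.

Definition derive_mx p q v (F : V -> 'M[K]_(p, q)) x : 'M[K]_(p, q) :=
  \matrix_(k, l) 'D_v (fun y => F y k l) x.

Lemma near_eq_differentiable_mx p q (F H : V -> 'M[K]_(p, q)) x :
  (\forall y \near x, F y = H y) -> differentiable_mx F x -> differentiable_mx H x.
Proof.
by move=> FH hF k l; apply: near_eq_differentiable (hF k l); apply: filterS FH => y ->.
Qed.

Lemma near_eq_derive_mx p q v (F H : V -> 'M[K]_(p, q)) x :
  (\forall y \near x, F y = H y) -> derive_mx v F x = derive_mx v H x.
Proof.
move=> FH; apply/matrixP => k l; rewrite !mxE; apply: near_eq_derive.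
by apply: filterS FH => y ->.
Qed.

Lemma derive_mx_cst p q v (A : 'M[K]_(p, q)) x : derive_mx v (fun=> A) x = 0.
Proof. by apply/matrixP => k l; rewrite !mxE derive_cst. Qed.

Lemma differentiable_mx_cst p q (A : 'M[K]_(p, q)) x : differentiable_mx (fun=> A) x.
Proof. by move=> k l; exact: (differentiable_cst (A k l)). Qed.

Lemma differentiable_mx_tr p q (F : V -> 'M[K]_(p, q)) x :
  differentiable_mx F x -> differentiable_mx (fun y => (F y)^T) x.
Proof.
move=> hF k l; rewrite (_ : (fun y => _) = (fun y => F y l k)) //.
by apply/funext => y; rewrite mxE.
Qed.

Lemma derive_mx_tr p q v (F : V -> 'M[K]_(p, q)) x :
  derive_mx v (fun y => (F y)^T) x = (derive_mx v F x)^T.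
Proof.
apply/matrixP => k l; rewrite !mxE; congr ('D_v _ _).
by apply/funext => y; rewrite mxE.
Qed.

Let mulmx_entry p q r (F : V -> 'M[K]_(p, q)) (H : V -> 'M[K]_(q, r)) k l :
  (fun y => (F y *m H y) k l) = (fun y => \sum_j F y k j * H y j l).
Proof. by apply/funext => y; rewrite mxE. Qed.

Let scalemx_entry p q (c : V -> K) (F : V -> 'M[K]_(p, q)) k l :
  (fun y => (c y *: F y) k l) = (fun y => c y * F y k l).
Proof. by apply/funext => y; rewrite mxE. Qed.

Let summx_entry p q r (F : 'I_r -> V -> 'M[K]_(p, q)) k l :
  (fun y => (\sum_j F j y) k l) = (fun y => \sum_j F j y k l).
Proof. by apply/funext => y; rewrite summxE. Qed.

Lemma differentiable_mxM p q r (F : V -> 'M[K]_(p, q)) (H : V -> 'M[K]_(q, r)) x :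
  differentiable_mx F x -> differentiable_mx H x ->
  differentiable_mx (fun y => F y *m H y) x.
Proof.
move=> hF hH k l; rewrite mulmx_entry.
by apply: diff_big_sum => j; apply: differentiableM; [exact: hF|exact: hH].
Qed.

Lemma derive_mxM p q r v (F : V -> 'M[K]_(p, q)) (H : V -> 'M[K]_(q, r)) x :
  differentiable_mx F x -> differentiable_mx H x ->
  derive_mx v (fun y => F y *m H y) x = derive_mx v F x *m H x + F x *m derive_mx v H x.
Proof.
move=> hF hH; apply/matrixP => k l; rewrite !mxE mulmx_entry diff_derive_sum; last first.
  by move=> j; apply: differentiableM; [exact: hF|exact: hH].
rewrite -big_split; apply: eq_bigr => j _.
by rewrite diff_deriveM ?mxE; [|exact: hF|exact: hH].
Qed.

Lemma differentiable_mxZ p q (c : V -> K) (F : V -> 'M[K]_(p, q)) x :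
  differentiable c x -> differentiable_mx F x ->
  differentiable_mx (fun y => c y *: F y) x.
Proof.
by move=> hc hF k l; rewrite scalemx_entry; apply: differentiableM; last exact: hF.
Qed.

Lemma derive_mxZ p q v (c : V -> K) (F : V -> 'M[K]_(p, q)) x :
  differentiable c x -> differentiable_mx F x ->
  derive_mx v (fun y => c y *: F y) x = 'D_v c x *: F x + c x *: derive_mx v F x.
Proof.
move=> hc hF; apply/matrixP => k l; rewrite !mxE scalemx_entry.
by rewrite diff_deriveM //; exact: hF.
Qed.

Lemma differentiable_mx_sum p q r (F : 'I_r -> V -> 'M[K]_(p, q)) x :
  (forall j, differentiable_mx (F j) x) -> differentiable_mx (fun y => \sum_j F j y) x.
Proof.
by move=> hF k l; rewrite summx_entry; apply: diff_big_sum => j; apply: hF.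
Qed.

Lemma derive_mx_sum p q r v (F : 'I_r -> V -> 'M[K]_(p, q)) x :
  (forall j, differentiable_mx (F j) x) ->
  derive_mx v (fun y => \sum_j F j y) x = \sum_j derive_mx v (F j) x.
Proof.
move=> hF; apply/matrixP => k l; rewrite mxE summxE summx_entry.
rewrite diff_derive_sum; last by move=> j; apply: hF.
by apply: eq_bigr => j _; rewrite mxE.
Qed.

End MatrixDerivatives.

(** * The complex exponential *)

Section ComplexExponential.
Variable R : realType.
Local Open Scope complex_scope.
Local Notation normc := (@ComplexField.Normc.normc R).

Definition cexp (z : CC R) : CC R :=
  let: a +i* b := (z : R[i]) in (expR a * cos b) +i* (expR a * sin b).

Lemma cexpD (z w : CC R) : cexp (z + w) = cexp z * cexp w.
Proof.
case: z w => [a b] [c d]; rewrite /cexp; simpc.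
apply/eqP; rewrite eq_complex /= expRD sinD cosD; apply/andP; split; apply/eqP; ring.
Qed.

Lemma cexp0 : cexp 0 = 1.
Proof. by rewrite /cexp /= expR0 cos0 sin0 mulr1 mulr0. Qed.

Lemma cexp_neq0 (z : CC R) : cexp z != 0.
Proof.
apply/eqP => z0; have /eqP := cexpD z (- z).
by rewrite subrr z0 mul0r cexp0 oner_eq0.
Qed.

(** An explicit bound, so that the expansions of exp, cos and sin at 0 can be combined by linear
    arithmetic. *)
Lemma is_derive_remainder (f : R -> R) (l eps : R) :
  is_derive (0 : R) (1 : R) f l -> 0 < eps ->
  exists2 d : R, 0 < d &
    forall t, `|t| < d -> `|f t - f 0 - l * t| <= eps * `|t|.
Proof.
move=> [df dfl] eps0.
have hf : differentiable f 0 by apply/derivable1_diffP.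
have /eqaddoP/(_ _ eps0)/nbhs_ballP[d /= d0 near0] := diff_locally hf.
exists d => // t td; move: (near0 t); rewrite -ball_normE /ball_ /= sub0r normrN => /(_ td).
rewrite diff1E // derive1E dfl /=.
have -> : (f \o shift 0 - (cst (f 0) + *:%R^~ l)) t = f (t + 0) - (f 0 + t * l) by [].
by rewrite addr0 opprD addrA [l * t]mulrC.
Qed.

Lemma normc_le_ReIm (x y : R) : normc (x +i* y) <= `|x| + `|y|.
Proof.
rewrite /ComplexField.Normc.normc -[leRHS]ger0_norm ?addr_ge0 // -sqrtr_sqr ler_wsqrtr // sqrrD.
by rewrite !real_normK ?num_real // lerD2r lerDl mulrn_wge0 ?mulr_ge0.
Qed.

Lemma ReIm_le_normc (x y : R) : `|x| <= normc (x +i* y) /\ `|y| <= normc (x +i* y).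
Proof.
by split; rewrite /ComplexField.Normc.normc -sqrtr_sqr ler_wsqrtr // ?lerDl ?lerDr sqr_ge0.
Qed.

Lemma cexp_remainder (eps : R) : 0 < eps -> exists2 d : R, 0 < d &
  forall h : R[i], normc h < d -> normc (cexp h - 1 - h) <= eps * normc h.
Proof.
move=> eps0.
(* With r = |h| < e, the real part of the remainder is at most 4 e r and the imaginary part at most
   5 e r, whence the 9. The bound e <= 1 gives r < 1 and so exp a <= 3. *)
have [e e0 [e1 e9]] : exists2 e : R, 0 < e & e <= 1 /\ e * 9 <= eps.
  exists (Num.min 1 (eps / 9)); first by rewrite lt_min ltr01 /=; lra.
  by rewrite -ler_pdivlMr // !ge_min !lexx orbT.
have [d1 d1_gt0 h1] := is_derive_remainder (is_derive_expR (0 : R)) e0.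
have [d2 d2_gt0 h2] := is_derive_remainder (is_derive_cos (0 : R)) e0.
have [d3 d3_gt0 h3] := is_derive_remainder (is_derive_sin (0 : R)) e0.
exists (Num.min e (Num.min d1 (Num.min d2 d3))); first by rewrite !lt_min e0 d1_gt0 d2_gt0.
case=> a b; set r := normc _; rewrite !lt_min => /and4P[re r1 r2 r3].
have [ar br] : `|a| <= r /\ `|b| <= r by exact: ReIm_le_normc.
have r0 : 0 <= r by exact: le_trans ar.
have {}h1 := h1 a (le_lt_trans ar r1).
have {}h2 := h2 b (le_lt_trans br r2).
have {}h3 := h3 b (le_lt_trans br r3).
move: h1 h2 h3; rewrite expR0 cos0 sin0 !oppr0 mul0r !(subr0, addr0) !mul1r => h1 h2 h3.
have -> : cexp (a +i* b) - 1 - (a +i* b) =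
   (expR a * (cos b - 1) + (expR a - 1 - a)) +i*
   (expR a * (sin b - b) + (expR a - 1) * b).
  by rewrite /cexp; apply/eqP; rewrite eq_complex /=; apply/andP; split; apply/eqP; ring.
apply: le_trans (normc_le_ReIm _ _) _.
have er : e * `|a| <= e * r by rewrite ler_pM2l.
have ebr : e * `|b| <= e * r by rewrite ler_pM2l.
have err : e * r <= r by rewrite ler_piMl.
have expa : `|expR a - 1| <= 2 * r.
  have -> : expR a - 1 = (expR a - 1 - a) + a by ring.
  by rewrite (le_trans (ler_normD _ _)) //; lra.
have expa3 : expR a <= 3.
  by have := ler_norm (expR a - 1); lra.
have expa0 := expR_ge0 a.
have u1 : `|expR a * (cos b - 1)| <= 3 * (e * r).
  by rewrite normrM ger0_norm // ler_pM // (le_trans h2).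
have u2 : `|expR a * (sin b - b)| <= 3 * (e * r).
  by rewrite normrM ger0_norm // ler_pM // (le_trans h3).
have u3 : `|(expR a - 1) * b| <= 2 * (e * r).
  rewrite normrM (le_trans (ler_pM _ _ expa br)) // -mulrA ler_pM2l //.
  by rewrite ler_wpM2r // ltW.
have u4 := ler_normD (expR a * (cos b - 1)) (expR a - 1 - a).
have u5 := ler_normD (expR a * (sin b - b)) ((expR a - 1) * b).
have : e * 9 * r <= eps * r by rewrite ler_wpM2r.
lra.
Qed.

(** By [cexpD] the remainder at z is cexp z times the remainder at 0, so the estimate at 0 with
    tolerance e / |cexp z| suffices. *)
Lemma is_diff_cexp (z : CC R) : is_diff z cexp ( *:%R (cexp z)).
Proof.
have lin_cont : continuous ( *:%R (cexp z) : CC R -> CC R) by exact: scaler_continuous.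
have rem : cexp \o shift z = cst (cexp z) + *:%R (cexp z) +o_ (0 : CC R) id.
  apply/eqaddoP => e e0.
  have ez0 : 0 < e / `|cexp z| by rewrite divr_gt0 // normr_gt0 cexp_neq0.
  (* The norm of [CC R] takes values in [R[i]], so the tolerance is a complex number; being positive
     it is real, as the estimate at 0 requires. *)
  have [eps eps0 epsE] : exists2 eps : R, 0 < eps & eps%:C = e / `|cexp z|.
    have : e / `|cexp z| \is Num.real by apply: gtr0_real.
    case/complex_realP => eps epsE; exists eps => //.
    by rewrite -ltcR -epsE.
  have [d d0 rem] := cexp_remainder eps0.
  apply/nbhs_ballP; exists (d%:C : CC R); first by rewrite /= ltcR.
  move=> h; rewrite -ball_normE /ball_ /= sub0r normrN => hd.
  have -> : (cexp \o shift z - (cst (cexp z) + *:%R (cexp z))) h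
     = cexp (h + z) - (cexp z + cexp z * h) by [].
  rewrite cexpD [cexp h * _]mulrC.
  have -> : cexp z * cexp h - (cexp z + cexp z * h) = cexp z * (cexp h - 1 - h).
    by rewrite !mulrBr mulr1 opprD addrA.
  rewrite normrM -ler_pdivlMl ?normr_gt0 ?cexp_neq0 // mulrA [_^-1 * e]mulrC -epsE.
  have := rem h; rewrite -ltcR -lecR rmorphM; exact.
have df := diff_unique lin_cont rem.
split; last exact: df.
by apply/diff_locallyP; rewrite df; split; [exact: lin_cont | exact: rem].
Qed.

Variables (n : nat) (f : 'rV[CC R]_n -> CC R) (x : 'rV[CC R]_n).

Lemma holo_cexp : holo f x -> holo (cexp \o f) x.
Proof. by move=> hf; apply: differentiable_comp => //; have [] := is_diff_cexp (f x). Qed.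

Lemma pd_cexp a : holo f x -> pd a (cexp \o f) x = cexp (f x) * pd a f x.
Proof.
by move=> hf; exact: derive_comp_scale hf (is_diff_cexp (f x)).
Qed.

End ComplexExponential.

(** * Clifford multiplication and pure spinors *)

(** Factor P = A B through its rank. Cancelling A and B in P P = P leaves B A = 1, and the trace of
    A B is that of B A. *)
Lemma rank_idempotent (K : fieldType) D (P : 'M[K]_D) :
  P *m P = P -> \tr P = (\rank P)%:R.
Proof.
move: (mulmx_base P) (row_base_free P) (col_base_full P).
move: (col_base P) (row_base P) => A B AB freeB /row_fullP[A' A'A] PP.
suff BA : B *m A = 1%:M by rewrite -[in LHS]AB mxtrace_mulC BA mxtrace1.
apply: (row_free_inj freeB); rewrite mul1mx -[LHS]mul1mx -[RHS]mul1mx -A'A -!mulmxA.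
by rewrite AB (mulmxA A) AB PP.
Qed.

(** * Annihilation operators and the projection onto the vacuum line *)

Section FockProjection.
Variables (K : numFieldType) (I : eqType) (D : nat) (w w' : I -> 'M[K]_D).
Hypothesis ww0 : forall i, w i *m w i = 0.
Hypothesis wwC : forall i j, w i *m w j = - (w j *m w i).
Hypothesis ww'C : forall i j, w i *m w' j + w' j *m w i = (i == j)%:R%:M.

Let P (s : seq I) : 'M[K]_D := foldr (fun i Q => w' i *m w i *m Q) 1%:M s.

Let P_comm s j : j \notin s -> w j *m P s = P s *m w j.
Proof.
elim: s => [|i s IH]; first by rewrite mul1mx mulmx1.
rewrite inE negb_or => /andP[ji js] /=.
have ww' : w j *m w' i = - (w' i *m w j).
  by apply/eqP; rewrite -addr_eq0 ww'C (negPf ji) raddf0.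
rewrite -!mulmxA (mulmxA (w j)) ww' mulNmx -mulmxA (mulmxA (w j) (w i)) wwC.
by rewrite mulNmx mulmxN opprK -!mulmxA IH.
Qed.

Let P_kill s i : uniq s -> i \in s -> P s *m w i = 0.
Proof.
elim: s => //= j s IH /andP[js us]; rewrite inE => /predU1P[->|si].
  by rewrite -!mulmxA -P_comm // (mulmxA (w j)) ww0 mul0mx mulmx0.
by rewrite -mulmxA IH // mulmx0.
Qed.

(** Insert 1 = w_i w'_i + w'_i w_i in front of [P s]: both halves have the same trace, because w_i
    commutes with [P s] and the trace is cyclic. *)
Let P_tr s : uniq s -> \tr (P s) * 2 ^+ size s = D%:R.
Proof.
elim: s => [_|i s IH /=/andP[js us]]; first by rewrite mulr1 mxtrace1.
rewrite exprS mulrA -IH //; congr (_ * _).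
rewrite mulr_natr mulr2n -[RHS](congr1 mxtrace (mul1mx (P s))).
have <- : w i *m w' i + w' i *m w i = 1%:M by rewrite ww'C eqxx.
rewrite mulmxDl linearD /=; congr (_ + _).
by rewrite -mulmxA P_comm // mulmxA mxtrace_mulC mulmxA.
Qed.

Let P_fix p s (u : 'M[K]_(p, D)) : (forall i, i \in s -> u *m w i = 0) -> u *m P s = u.
Proof.
elim: s => [|i s IH] us; first by rewrite mulmx1.
rewrite /= !mulmxA -[u *m _ *m _]mulmxA.
(* On a row vector killed by w_i, the factor w'_i w_i = 1 - w_i w'_i acts as the identity. *)
have -> : w' i *m w i = 1%:M - w i *m w' i.
  by apply/eqP; rewrite eq_sym subr_eq addrC ww'C eqxx.
rewrite mulmxBr mulmx1 mulmxA us ?mem_head // mul0mx subr0 IH // => j js.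
by rewrite us // inE js orbT.
Qed.

(* The idempotents w'_i w_i need not commute, but their product is still a
   projection onto the joint kernel of the w_i, and each factor halves the trace. *)
Lemma fock_projection s : uniq s -> D = (2 ^ size s)%N ->
  exists2 Q : 'M[K]_D, \rank Q = 1%N &
    forall p (u : 'M[K]_(p, D)), (forall i, i \in s -> u *m w i = 0) -> u *m Q = u.
Proof.
move=> us Ds; exists (P s); last by move=> p u; apply: P_fix.
have PP : P s *m P s = P s by apply: P_fix => i; apply: P_kill.
have Ds' : D%:R = 2 ^+ size s :> K by rewrite Ds natrX.
have /eqP := P_tr us; rewrite rank_idempotent // Ds' -subr_eq0 -{2}[_ ^+ _]mul1r -mulrBl.
rewrite mulf_eq0 expf_eq0 pnatr_eq0 andbF orbF subr_eq0.
by rewrite (eqr_nat K _ 1) => /eqP.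
Qed.

End FockProjection.

(** * Clifford relations and commutators *)

Section Slash.
Variables (K : numFieldType) (n N : nat).
Implicit Types (gam gp gm : 'I_n -> 'M[K]_N) (g h : 'M[K]_n) (u v : 'rV[K]_n).

(** The relation on the spinors on which [gp] acts; the one on the other chirality is
    [clifford g gm gp]. *)
Definition clifford g gp gm : Prop :=
  forall a b, gp a *m gm b + gp b *m gm a = (- 2 * g a b)%:M.

Definition slash gam u : 'M[K]_N := \sum_a u 0 a *: gam a.

Lemma slash_delta gam a : slash gam (delta_mx 0 a) = gam a.
Proof.
rewrite /slash (bigD1 a) //= big1 ?addr0 => [|b ba]; rewrite !mxE ?eqxx ?scale1r //=.
by rewrite (negPf ba) scale0r.
Qed.

Lemma slashD gam u v : slash gam (u + v) = slash gam u + slash gam v.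
Proof.
by rewrite /slash -big_split; apply: eq_bigr => a _; rewrite mxE scalerDl.
Qed.

Lemma slash_mulmx_row gam u h : slash gam (u *m h) = \sum_b u 0 b *: slash gam (row b h).
Proof.
under eq_bigr do rewrite /slash scaler_sumr.
rewrite exchange_big; apply: eq_bigr => a _; rewrite mxE scaler_suml.
by apply: eq_bigr => b _; rewrite mxE scalerA.
Qed.

Lemma slash_clifford g gp gm u v : clifford g gp gm ->
  slash gp u *m slash gm v + slash gp v *m slash gm u
  = (- 2 * (u *m g *m v^T) 0 0)%:M.
Proof.
move=> cl.
have slashM (f k : 'I_n -> 'M[K]_N) y z : slash f y *m slash k z =
    \sum_a \sum_b (y 0 a * z 0 b) *: (f a *m k b).
  rewrite /slash mulmx_suml; apply: eq_bigr => a _.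
  rewrite mulmx_sumr; apply: eq_bigr => b _.
  by rewrite -scalemxAl -scalemxAr scalerA.
rewrite !slashM [X in _ + X]exchange_big -big_split /= mxE mulr_sumr raddf_sum.
rewrite [RHS]/=; under [RHS]eq_bigr do rewrite !mxE mulr_suml mulr_sumr raddf_sum.
rewrite [RHS]exchange_big /=; apply: eq_bigr => a _; rewrite -big_split.
apply: eq_bigr => b _ /=; rewrite [v 0 b * _]mulrC -scalerDr cl scale_scalar_mx.
by congr (_%:M); ring.
Qed.

Lemma slash_anticomm g gp gm u v : clifford g gp gm ->
  slash gp u *m slash gm v =
  - (slash gp v *m slash gm u) - (2 * (u *m g *m v^T) 0 0)%:M.
Proof.
move=> /(slash_clifford u v) /(canRL (addrK _)) ->.
by rewrite addrC mulNr raddfN.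
Qed.

(** Move gamma_b to the left past gamma_a, then past u. Half of this commutator is what the change
    of the spin connections contributes to the derivative of the rescaled gamma_b. *)
Lemma weyl_commutator g gp gm u a b : clifford g gp gm -> clifford g gm gp ->
  slash gp u *m gm a *m gp b - gp b *m slash gm u *m gp a =
  (2 * (u *m g) 0 b) *: gp a - (2 * g a b) *: slash gp u.
Proof.
move=> clp clm.
have -> : slash gp u *m gm a *m gp b =
    - (slash gp u *m gm b *m gp a) - (2 * g a b) *: slash gp u.
  rewrite -!mulmxA (canRL (addrK _) (clm a b)) addrC mulmxDr mulmxN mul_mx_scalar.
  by rewrite mulNr scaleNr.
rewrite -{1}(slash_delta gm b) (slash_anticomm u _ clp) slash_delta trmx_delta -colE mxE.
rewrite mulmxBl mulNmx mul_scalar_mx opprB addrAC; congr (_ + _).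
by rewrite opprK addrK.
Qed.

(** Quadratic Clifford elements act on vectors by infinitesimal rotations. Each commutator is twice
    a difference of two vectors, whose sums agree because [om] is skew; hence the 4, matched by the
    coefficient -1/4 of the spin connection. *)
Lemma spin_rotation gp gm v (om : 'M[K]_n) :
  clifford 1%:M gp gm -> clifford 1%:M gm gp -> om^T = - om ->
  slash gp v *m (\sum_k \sum_l om k l *: (gm k *m gp l))
  - (\sum_k \sum_l om k l *: (gp k *m gm l)) *m slash gp v
  = 4 *: slash gp (v *m om^T).
Proof.
move=> clp clm om_skew.
have comm k l : slash gp v *m (gm k *m gp l) - gp k *m gm l *m slash gp v =
    2 *: (v 0 l *: gp k - v 0 k *: gp l).
  have -> : gp k *m gm l *m slash gp v =
      - (gp k *m slash gm v *m gp l) - (2 * v 0 l) *: gp k.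
    rewrite -!mulmxA -{1}(slash_delta gm l) (slash_anticomm _ v clm) slash_delta.
    by rewrite mulmx1 -rowE !mxE mulmxBr mulmxN mul_mx_scalar.
  have -> : gp k *m slash gm v *m gp l =
      - (slash gp v *m gm k *m gp l) - (2 * v 0 k) *: gp l.
    rewrite -{1}(slash_delta gp k) (slash_anticomm _ v clp) slash_delta.
    by rewrite mulmx1 -rowE !mxE mulmxBl mulNmx mul_scalar_mx.
  rewrite mulmxA scalerBr !scalerA; set X := slash gp v *m _ *m _.
  by rewrite [- (- X - _)]opprB opprK opprB addrC opprD addrA subrK.
rewrite mulmx_sumr mulmx_suml -sumrB.
transitivity (\sum_k \sum_l 2 *: ((v 0 l * om k l) *: gp k - (v 0 k * om k l) *: gp l)).
  apply: eq_bigr => k _; rewrite mulmx_sumr mulmx_suml -sumrB; apply: eq_bigr => l _.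
  rewrite -scalemxAr -scalemxAl -scalerBr comm !scalerA scalerBr !scalerA.
  by rewrite !scalerBr !scalerA; congr (_ *: _ - _ *: _); ring.
under eq_bigr do rewrite -scaler_sumr.
rewrite -scaler_sumr (_ : 4 = 2 * 2 :> K); last by ring.
rewrite -scalerA; congr (_ *: _); under eq_bigr do rewrite sumrB.
rewrite sumrB scaler_nat mulr2n; congr (_ + _).
  apply: eq_bigr => k _; rewrite mxE scaler_suml.
  by apply: eq_bigr => l _; rewrite mxE.
rewrite exchange_big -sumrN; apply: eq_bigr => l _.
by rewrite om_skew mulmxN !mxE scaleNr scaler_suml.
Qed.

End Slash.

(** * Contraction identities of a pure spinor *)

Section PureSpinor.
Variables (K : numFieldType) (n N : nat) (g h : 'M[K]_n) (gp gm : 'I_n -> 'M[K]_N).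
Implicit Types u v : 'rV[K]_n.
Hypotheses (gT : g^T = g) (gh : g *m h = 1%:M).
Hypotheses (clp : clifford g gp gm) (clm : clifford g gm gp).
Variables (xi : 'rV[K]_N).

Let hg : h *m g = 1%:M. Proof. exact: mulmx1C. Qed.

Let hT : h^T = h.
Proof.
by rewrite -[LHS]mulmx1 -gh mulmxA -[X in _ *m X *m _]gT -trmx_mul gh trmx1 mul1mx.
Qed.

Let metric_row u b : (u *m g *m (row b h)^T) 0 0 = u 0 b.
Proof. by rewrite tr_row hT colE mulmxA -(mulmxA u) gh mulmx1 -colE mxE. Qed.

Let metric_delta_row a b :
  ((delta_mx 0 a : 'rV[K]_n) *m g *m (row b h)^T) 0 0 = (a == b)%:R.
Proof. by rewrite metric_row mxE eqxx eq_sym. Qed.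

Let metric_delta u a : (u *m g *m (delta_mx 0 a : 'rV[K]_n)^T) 0 0 = (u *m g) 0 a.
Proof. by rewrite trmx_delta -colE mxE. Qed.

(** The rows are the xi_a, so [kermx L] spans the vectors u with u^a xi_a = 0. *)
Let L := \matrix_a (xi *m gp a).

Lemma mulmx_slash u : u *m L = xi *m slash gp u.
Proof.
rewrite mulmx_sum_row mulmx_sumr; apply: eq_bigr => a _.
by rewrite rowK scalemxAr.
Qed.

(** The Clifford relation applied to xi gives - 2 g(u, v) xi = 0. *)
Lemma slash_kernel_null u v : xi != 0 ->
  xi *m slash gp u = 0 -> xi *m slash gp v = 0 -> u *m g *m v^T = 0.
Proof.
move=> xi0 xu xv; have := congr1 (mulmx xi) (slash_clifford u v clp).
rewrite mulmxDr !mulmxA xu xv !mul0mx addr0 mul_mx_scalar => /esym/eqP.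
rewrite scaler_eq0 (negPf xi0) orbF mulf_eq0 oppr_eq0 pnatr_eq0 /= => /eqP uv.
by apply/matrixP => i j; rewrite !ord1 uv mxE.
Qed.

Lemma kermx_null : xi != 0 -> kermx L *m g *m (kermx L)^T = 0.
Proof.
move=> xi0; apply/matrixP => i j; rewrite [RHS]mxE.
have ker k : xi *m slash gp (row k (kermx L)) = 0.
  by rewrite -mulmx_slash -row_mul mulmx_ker row0.
have := slash_kernel_null xi0 (ker i) (ker j).
move=> /matrixP/(_ 0 0); rewrite -row_mul mxE [RHS]mxE => <-.
by rewrite [LHS]mxE; apply: eq_bigr => k _; rewrite !mxE.
Qed.

(* The kernel of xi_a^A is null of half the dimension, so it is its own
   orthogonal complement, which is the span of the vectors xi^{aA}. *)
Lemma pure_contraction m : n = (2 * m)%N -> xi != 0 -> \rank (kermx L) = m ->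
  L^T *m h *m L = 0.
Proof.
move=> n2m xi0 rk; apply/eqP; rewrite -sub_kermx.
have gunit : g \in unitmx by case/mulmx1_unit: gh.
have rkW : \rank (g *m (kermx L)^T) = m.
  by rewrite eqmxMfull ?mxrank_tr // row_full_unit.
have sub : (kermx L <= kermx (g *m (kermx L)^T))%MS.
  by apply/sub_kermxP; rewrite mulmxA kermx_null.
have rkker : \rank (kermx (g *m (kermx L)^T)) = m.
  by rewrite mxrank_ker rkW {1}n2m mul2n -addnn addnK.
have [_ /esym] := mxrank_leqif_eq sub; rewrite rk rkker eqxx => /eqmxP ->.
by apply/sub_kermxP; rewrite -mulmxA (mulmxA h) hg mul1mx -trmx_mul mulmx_ker trmx0.
Qed.

(** Both sides are xi^{bB} xi_b^C: the matrix form suits the rank argument, the sum the later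
    computations. *)
Lemma contraction_sum : L^T *m h *m L =
  \sum_b (xi *m slash gp (row b h))^T *m (xi *m gp b).
Proof.
have -> : L^T *m h = (h *m L)^T by rewrite trmx_mul hT.
apply/matrixP => i j; rewrite summxE mxE; apply: eq_bigr => b _.
by rewrite -mulmx_slash -row_mul [RHS]mxE big_ord1 !mxE.
Qed.

Hypothesis contr0 : \sum_b (xi *m slash gp (row b h))^T *m (xi *m gp b) = 0.

Variable u : 'rV[K]_n.
Let z := xi *m slash gp u.

(** gamma^b is moved to the left past gamma_a and u until it meets xi. The term beginning with xi
    gamma^b vanishes against xi_b by [contr0], and the two Clifford brackets passed on the way give
    the right-hand side. *)
Lemma contraction_weyl a :
  \sum_b (z *m gm a *m slash gp (row b h))^T *m (xi *m gp b) =
  2 *: ((xi *m gp a)^T *m z - z^T *m (xi *m gp a)).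
Proof.
have termE b : z *m gm a *m slash gp (row b h) =
    xi *m slash gp (row b h) *m (slash gm u *m gp a)
    + (2 * u 0 b) *: (xi *m gp a) - (2 * (a == b)%:R) *: z.
  rewrite -{1}(slash_delta gm a) -mulmxA (slash_anticomm _ _ clm) metric_delta_row.
  rewrite slash_delta mulmxBr mulmxN mul_mx_scalar; congr (_ - _).
  rewrite /z !mulmxA -(mulmxA xi (slash gp u)) (slash_anticomm u _ clp) metric_row.
  rewrite mulmxBr mulmxN mul_mx_scalar mulmxBl mulNmx opprB -scalemxAl addrC opprK.
  by rewrite !mulmxA.
under eq_bigr do rewrite termE linearB linearD /= mulmxBl mulmxDl !linearZ /=
  -!scalemxAl trmx_mul -mulmxA.
rewrite big_split sumrN big_split /= -mulmx_sumr contr0 mulmx0 add0r scalerBr; congr (_ - _).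
  under eq_bigr do rewrite -scalerA scalemxAr.
  rewrite -scaler_sumr -mulmx_sumr; congr (_ *: (_ *m _)).
  by rewrite /z mulmx_sumr; under eq_bigr do rewrite scalemxAr.
rewrite (bigD1 a) //= eqxx mulr1 big1 ?addr0 // => b ba.
by rewrite eq_sym (negPf ba) mulr0 scale0r.
Qed.

(** Moving gamma_b past u produces a term beginning with xi_b, killed by [contr0], and the bracket -
    2 u_b xi, whose contraction with xi^b rebuilds z. *)
Lemma contraction_weyl_spinor :
  \sum_b (xi *m slash gp (row b h))^T *m (z *m gm b) = - 2 *: (z^T *m xi).
Proof.
have termE b : z *m gm b = - (xi *m gp b *m slash gm u) - (2 * (u *m g) 0 b) *: xi.
  rewrite /z -{1}(slash_delta gm b) -mulmxA (slash_anticomm _ _ clp) metric_delta.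
  by rewrite slash_delta mulmxBr mulmxN mul_mx_scalar mulmxA.
under eq_bigr do rewrite termE mulmxBr mulmxN mulmxA -scalemxAr.
rewrite big_split !sumrN /= -mulmx_suml contr0 mul0mx oppr0 add0r scaleNr; congr (- _).
have linE (c : K) (A : 'M[K]_N) :
    (2 * c) *: ((xi *m A)^T *m xi) = 2 *: ((xi *m (c *: A))^T *m xi).
  by rewrite -scalemxAr linearZ /= -scalemxAl scalerA.
under eq_bigr do rewrite linE.
rewrite -scaler_sumr -mulmx_suml -linear_sum -mulmx_sumr /= -slash_mulmx_row.
by rewrite -mulmxA gh mulmx1.
Qed.

(** The sum does not depend on which of its two indices is raised, so twice the sum is the trace of
    the Clifford relation. *)
Lemma clifford_trace : \sum_b gm b *m slash gp (row b h) = (- n%:R)%:M.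
Proof.
have sym : \sum_b gm b *m slash gp (row b h) = \sum_b slash gm (row b h) *m gp b.
  under eq_bigr do rewrite /slash mulmx_sumr.
  under [RHS]eq_bigr do rewrite /slash mulmx_suml.
  rewrite [RHS]exchange_big; apply: eq_bigr => a _; apply: eq_bigr => b _.
  by rewrite !mxE -scalemxAl -scalemxAr -{1}hT mxE.
have two : (2 : K) != 0 by rewrite pnatr_eq0.
apply: (scalerI two); rewrite scaler_nat mulr2n {2}sym -big_split /=.
under eq_bigr => b _.
  rewrite -{1}(slash_delta gm b) -[X in _ + _ *m X](slash_delta gp b).
  rewrite (slash_clifford _ _ clm) metric_delta_row eqxx mulr1; over.
rewrite sumr_const card_ord scale_scalar_mx -raddfMn /=; congr (_%:M).
by rewrite mulrN mulr_natr mulNrn.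
Qed.

End PureSpinor.

(** * A maximal null subspace determines its pure spinor up to scale *)

Section PureSpinorLine.
Variables (K : numFieldType) (n N : nat) (g : 'M[K]_n) (gp gm : 'I_n -> 'M[K]_N).
Hypotheses (gT : g^T = g) (gu : g \in unitmx).
Hypotheses (clp : clifford g gp gm) (clm : clifford g gm gp).

(* Clifford multiplication on S^+ (+) S^-. *)
Let G (u : 'rV[K]_n) : 'M[K]_(N + N) := block_mx 0 (slash gp u) (slash gm u) 0.

Let G_clifford u v : G u *m G v + G v *m G u = (- 2 * (u *m g *m v^T) 0 0)%:M.
Proof.
rewrite !mulmx_block !mulmx0 !mul0mx !addr0 !add0r add_block_mx !addr0.
by rewrite (slash_clifford _ _ clp) (slash_clifford _ _ clm) -scalar_mx_block.
Qed.

(** The r rows of W act as annihilation operators on a space of dimension 2^r. The vectors they all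
    kill lie in the image of a projection of rank 1, which xi spans and which therefore contains
    p. *)
Lemma null_annihilator_line r (W : 'M[K]_(r, n)) (xi p : 'rV[K]_N) :
  (N + N = 2 ^ r)%N -> row_free W -> W *m g *m W^T = 0 -> xi != 0 ->
  (forall i, xi *m slash gp (row i W) = 0) ->
  (forall i, p *m slash gp (row i W) = 0) -> exists c, p = c *: xi.
Proof.
move=> dimN freeW nullW xi0 xiW pW.
(* The columns of B are dual to the rows of W under g. They need not be null, since
   [fock_projection] asks for no relation among the w'_i. *)
have /row_freeP[B WB] : row_free (W *m g) by rewrite /row_free mxrankMfree ?row_free_unit.
pose w i := G (row i W).
(* The factor -1/2 turns the Clifford bracket -2 g into the Kronecker delta. *)
pose w' i := - 2^-1 *: G (row i B^T).
have rowrow (A : 'M_(r, n)) i j :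
    (row i W *m g *m (row j A)^T) 0 0 = (W *m g *m A^T) i j.
  by rewrite -row_mul [LHS]mxE [RHS]mxE; apply: eq_bigr => k _; rewrite !mxE.
have two0 : (2 : K) != 0 by rewrite pnatr_eq0.
have wwC i j : w i *m w j = - (w j *m w i).
  by apply/eqP; rewrite -addr_eq0 G_clifford rowrow nullW mxE mulr0 raddf0.
have ww0 i : w i *m w i = 0.
  by apply: (scalerI two0); rewrite scaler0 scaler_nat mulr2n {2}wwC subrr.
have ww'C i j : w i *m w' j + w' j *m w i = (i == j)%:R%:M.
  rewrite -scalemxAr -scalemxAl -scalerDr G_clifford rowrow trmxK WB mxE scale_scalar_mx.
  by rewrite mulrA mulrNN mulVf // mul1r.
have [|Q rkQ fixQ] := fock_projection ww0 wwC ww'C (enum_uniq 'I_r).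
  by rewrite -cardE card_ord.
have kill (q : 'rV_N) : (forall i, q *m slash gp (row i W) = 0) ->
    (row_mx q (0 : 'rV_N) <= Q)%MS.
  move=> qW; rewrite -[X in (X <= _)%MS]fixQ ?submxMl // => i _.
  by rewrite mul_row_block qW !mulmx0 !mul0mx !addr0 row_mx0.
have rk1 : \rank (row_mx xi (0 : 'rV_N)) = 1%N.
  by rewrite rank_rV row_mx_eq0 negb_and xi0.
have [_ /esym] := mxrank_leqif_sup (kill xi xiW).
rewrite rk1 rkQ eqxx => Qxi; have /sub_rVP[c] := submx_trans (kill p pW) Qxi.
by rewrite scale_row_mx => /eq_row_mx[pE _]; exists c.
Qed.

(** The vectors xi^{bB} span the kernel of xi_a by a count of dimensions, so the vanishing
    contraction says that this whole kernel also annihilates p. The kernel is null of rank m, and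
    [null_annihilator_line] applies. *)
Lemma pure_spinor_line m (xi p : 'rV[K]_N) :
  let L := \matrix_a (xi *m gp a) in
  n = (2 * m)%N -> (N + N = 2 ^ m)%N -> xi != 0 -> \rank (kermx L) = m ->
  \sum_b (p *m slash gp (row b (invmx g)))^T *m (xi *m gp b) = 0 ->
  exists c, p = c *: xi.
Proof.
move=> L n2m dimN xi0 rkL contr.
have gh : g *m invmx g = 1%:M by rewrite mulmxV.
have LhL := pure_contraction gh clp n2m xi0 rkL.
have Lh_ker : (L^T *m invmx g <= kermx L)%MS by apply/sub_kermxP.
have rkLh : \rank (L^T *m invmx g) = m.
  have invu : row_free (invmx g) by rewrite row_free_unit unitmx_inv.
  rewrite mxrankMfree // mxrank_tr; move: (rank_leq_row L) (mxrank_ker L).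
  by rewrite rkL; move: (\rank L) => r; lia.
have [_ /esym] := mxrank_leqif_sup Lh_ker; rewrite rkLh rkL eqxx => ker_Lh.
pose Lp := \matrix_a (p *m gp a).
have LpL : Lp^T *m invmx g *m L = 0.
  have hT : (invmx g)^T = invmx g by rewrite trmx_inv gT.
  have -> : Lp^T *m invmx g = (invmx g *m Lp)^T by rewrite trmx_mul hT.
  rewrite -[RHS]contr; apply/matrixP => i j; rewrite summxE mxE.
  by apply: eq_bigr => b _; rewrite -mulmx_slash -row_mul [RHS]mxE big_ord1 !mxE.
have ker_Lp : kermx L *m Lp = 0.
  have /submxP[A ->] := ker_Lh; rewrite -mulmxA -[RHS](mulmx0 _ A); congr (_ *m _).
  by apply: trmx_inj; rewrite !trmx_mul trmxK trmx_inv gT trmx0 mulmxA.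
have ker_base : (row_base (kermx L) <= kermx L)%MS by rewrite eq_row_base.
apply: (@null_annihilator_line _ (row_base (kermx L)) xi p).
- by rewrite rkL.
- exact: row_base_free.
- have /submxP[A ->] := ker_base; rewrite trmx_mul mulmxA -!(mulmxA A).
  by rewrite (kermx_null clp xi0) mul0mx mulmx0.
- exact: xi0.
- move=> i; rewrite -mulmx_slash -row_mul (_ : _ *m _ = 0) ?row0 //.
  exact/sub_kermxP.
- move=> i; rewrite -mulmx_slash -row_mul (_ : _ *m _ = 0) ?row0 //.
  by have /submxP[A ->] := ker_base; rewrite -mulmxA ker_Lp mulmx0.
Qed.

End PureSpinorLine.

(** * Levi-Civita and spin connections *)

(* For D b the derivative of g along the b-th coordinate, the entry (d, c) is
   the Christoffel symbol Gamma_{d,ac} with its first index lowered. *)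
Definition lowered_christoffel (K : fieldType) n (D : 'I_n -> 'M[K]_n) (a : 'I_n) : 'M[K]_n :=
  \matrix_(d, c) (2^-1 * (D a c d + D c a d - D d a c)).

Lemma lowered_christoffel_compat (K : numFieldType) n (D : 'I_n -> 'M[K]_n) a :
  (forall b, (D b)^T = D b) ->
  lowered_christoffel D a + (lowered_christoffel D a)^T = D a.
Proof.
move=> DT; apply/matrixP => b c; rewrite !mxE.
have sym d i j : D d j i = D d i j by rewrite -{1}DT mxE.
rewrite (sym a b c).
by field.
Qed.

(** * Metric compatibility, and covariant derivatives when gamma is parallel *)

Section LeviCivita.
Variables (K : numFieldType) (n N : nat).
Implicit Types (a b c : 'I_n).
Variables (g : 'rV[K]_n -> 'M[K]_n) (x : 'rV[K]_n).
Local Notation D a F := (derive_mx (delta_mx 0 a : 'rV[K]_n) F x).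
Local Notation h := (invmx (g x)).

(** For fixed a, the entry (b, c) is Gamma^b_{ac}, as in [christoffel]. *)
Definition levi_civita a : 'M[K]_n := \matrix_(b, c)
  (2^-1 * \sum_d h b d *
    ('D_(delta_mx 0 a) (fun y => g y c d) x + 'D_(delta_mx 0 c) (fun y => g y a d) x
     - 'D_(delta_mx 0 d) (fun y => g y a c) x)).

Lemma levi_civitaE a : levi_civita a = h *m lowered_christoffel (fun b => D b g) a.
Proof.
apply/matrixP => b c; rewrite !mxE mulr_sumr; apply: eq_bigr => d _.
by rewrite !mxE mulrCA.
Qed.

Hypotheses (g_near : \forall y \near x, (g y)^T = g y /\ g y \in unitmx).
Hypothesis (diff_g : differentiable_mx g x).

Lemma metric_sym : (g x)^T = g x. Proof. by have [] := nbhs_singleton g_near. Qed.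

Lemma metric_unit : g x \in unitmx. Proof. by have [] := nbhs_singleton g_near. Qed.

Lemma derive_metric_sym a : (D a g)^T = D a g.
Proof.
rewrite -derive_mx_tr; apply: near_eq_derive_mx; near=> y.
by have [] := near g_near y.
Unshelve. all: by end_near. Qed.

Lemma metric_compat a : D a g = (levi_civita a)^T *m g x + g x *m levi_civita a.
Proof.
rewrite levi_civitaE trmx_mul mulmxA mulmxV ?metric_unit // mul1mx.
rewrite trmx_inv metric_sym mulmxKV ?metric_unit // addrC.
by rewrite lowered_christoffel_compat // => b; exact: derive_metric_sym.
Qed.

Hypothesis (diff_h : differentiable_mx (fun y => invmx (g y)) x).

(** Differentiate g g^-1 = 1 and use that g is parallel. *)
Lemma inverse_metric_compat a :
  D a (fun y => invmx (g y)) = - (levi_civita a *m h) - h *m (levi_civita a)^T.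
Proof.
have : D a (fun y => g y *m invmx (g y)) = 0.
  rewrite -[RHS](derive_mx_cst (delta_mx 0 a) (1%:M : 'M[K]_n) x).
  apply: near_eq_derive_mx; near=> y.
  by rewrite mulmxV //; have [] := near g_near y.
rewrite derive_mxM // metric_compat mulmxDl.
move/(congr1 (mulmx h)); rewrite mulmx0 !mulmxDr !mulmxA mulVmx ?metric_unit //.
rewrite !mul1mx -[_ *m g x *m h]mulmxA mulmxV ?metric_unit // mulmx1 addrC.
move=> /eqP; rewrite addr_eq0 => /eqP->.
by rewrite opprD addrC.
Unshelve. all: by end_near. Qed.

Section ParallelGamma.
Variables (gp : 'I_n -> 'rV[K]_n -> 'M[K]_N) (cp cm : 'I_n -> 'M[K]_N).
Variable (xi : 'rV[K]_n -> 'rV[K]_N).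
Hypothesis gp_parallel : forall a b,
  D a (gp b) - \sum_c levi_civita a c b *: gp c x + gp b x *m cm a - cp a *m gp b x = 0.
Hypotheses (diff_gp : forall a, differentiable_mx (gp a) x) (diff_xi : differentiable_mx xi x).
Let low b y := xi y *m gp b y.

Let diff_low b : differentiable_mx (low b) x. Proof. exact: differentiable_mxM. Qed.

(** The Leibniz rule for xi gamma_b, in which the parallel gamma_b contributes nothing. *)
Lemma nabla_low_parallel a b :
  D a (low b) - \sum_c levi_civita a c b *: low c x + low b x *m cm a
  = (D a xi + xi x *m cp a) *m gp b x.
Proof.
have -> : \sum_c levi_civita a c b *: low c x = xi x *m \sum_c levi_civita a c b *: gp c x.
  by rewrite mulmx_sumr; apply: eq_bigr => c _; rewrite scalemxAr.
rewrite derive_mxM // mulmxDl -!mulmxA -!addrA; congr (_ + _).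
rewrite -mulmxN -!mulmxDr; congr (_ *m _).
by apply/eqP; rewrite -subr_eq0 addrA gp_parallel.
Qed.

(** The inverse metric is parallel, so raising the index commutes with the covariant derivative and
    reduces this to the lowered case. *)
Lemma nabla_up_parallel a b :
  D a (fun y => \sum_c invmx (g y) b c *: low c y)
  + \sum_c levi_civita a b c *: (\sum_d h c d *: low d x)
  + (\sum_c h b c *: low c x) *m cm a
  = (D a xi + xi x *m cp a) *m (\sum_c h b c *: gp c x).
Proof.
rewrite derive_mx_sum; last first.
  by move=> c; apply: differentiable_mxZ; [exact: diff_h | exact: diff_low].
have -> : \sum_c levi_civita a b c *: (\sum_d h c d *: low d x) =
    \sum_c (levi_civita a *m h) b c *: low c x.
  under eq_bigr do rewrite scaler_sumr.
  rewrite exchange_big; apply: eq_bigr => d _; rewrite mxE scaler_suml.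
  by apply: eq_bigr => c _; rewrite scalerA.
have -> : \sum_c derive_mx (delta_mx 0 a) (fun y => invmx (g y) b c *: low c y) x =
    \sum_c (D a (fun y => invmx (g y)) b c *: low c x + h b c *: D a (low c)).
  apply: eq_bigr => c _; rewrite derive_mxZ; [|exact: diff_h|exact: diff_low].
  by congr (_ *: _ + _); rewrite mxE.
have -> : (D a xi + xi x *m cp a) *m (\sum_c h b c *: gp c x) =
    \sum_c h b c *: D a (low c) - \sum_c (h *m (levi_civita a)^T) b c *: low c x
    + \sum_c h b c *: (low c x *m cm a).
  rewrite mulmx_sumr; under eq_bigr do rewrite -scalemxAr -nabla_low_parallel scalerDr scalerBr.
  rewrite big_split sumrB /=; congr (_ - _ + _).
  under eq_bigr do rewrite scaler_sumr.
  rewrite exchange_big; apply: eq_bigr => d _; rewrite mxE scaler_suml.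
  by apply: eq_bigr => c _; rewrite [_^T _ _]mxE scalerA.
rewrite mulmx_suml; under [X in _ + X = _]eq_bigr do rewrite -scalemxAl.
congr (_ + _); rewrite big_split /= addrAC addrC -[in LHS]big_split /=; congr (_ + _).
rewrite -sumrN; apply: eq_bigr => c _.
by rewrite inverse_metric_compat -scalerDl !mxE addrAC addNr add0r scaleNr.
Qed.

End ParallelGamma.
End LeviCivita.

Lemma lowered_christoffel_conformal (K : numFieldType) n (D : 'I_n -> 'M[K]_n)
    (G : 'M[K]_n) (u : 'rV[K]_n) (s : K) a : G^T = G ->
  lowered_christoffel (fun b => s *: (D b + (2 * u 0 b) *: G)) a =
  s *: (lowered_christoffel D a
        + (u 0 a *: G + (row a G)^T *m u - u^T *m row a G)).
Proof.
move=> GT; have Gs i j : G j i = G i j by rewrite -[in LHS]GT mxE.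
apply/matrixP => d c; rewrite !mxE !big_ord1 !mxE (Gs d c).
by field.
Qed.

(** * Connections and gamma matrices of a rescaled metric *)

Section ConformalRescaling.
Variables (K : numFieldType) (n N : nat).
Implicit Types (a b c : 'I_n).
Variables (g : 'rV[K]_n -> 'M[K]_n) (x : 'rV[K]_n).
Hypotheses (g_near : \forall y \near x, (g y)^T = g y /\ g y \in unitmx).
Hypothesis (diff_g : differentiable_mx g x).
Variable Om : 'rV[K]_n -> K.
Hypotheses (diff_Om : differentiable Om x) (Om0 : Om x != 0).
Local Notation D a F := (derive_mx (delta_mx 0 a : 'rV[K]_n) F x).
Local Notation h := (invmx (g x)).

Let Ups : 'rV[K]_n := \row_b ((Om x)^-1 * 'D_(delta_mx 0 b) Om x).

Lemma derive_conformal_metric a :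
  D a (fun y => Om y ^+ 2 *: g y) = Om x ^+ 2 *: (D a g + (2 * Ups 0 a) *: g x).
Proof.
have -> : (fun y => Om y ^+ 2 *: g y) = (fun y => (Om y * Om y) *: g y).
  by apply/funext => y; rewrite expr2.
rewrite derive_mxZ ?diff_deriveM //; last exact: differentiableM.
rewrite scalerDr addrC -expr2; congr (_ + _); rewrite scalerA mxE; congr (_ *: _).
by field.
Qed.

(** The correction is Upsilon_a delta^b_c + delta^b_a Upsilon_c - Upsilon^b g_{ac}. The factor Om^2
    of the lowered symbols cancels against that of the inverse metric. *)
Lemma levi_civita_conformal a :
  levi_civita (fun y => Om y ^+ 2 *: g y) x a =
  levi_civita g x a + ((Ups 0 a)%:M + delta_mx a 0 *m Ups - (Ups *m h)^T *m row a (g x)).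
Proof.
have gT := metric_sym g_near; have gu := metric_unit g_near.
have Om2 : Om x ^+ 2 != 0 by rewrite expf_neq0.
pose E := Ups 0 a *: g x + (row a (g x))^T *m Ups - Ups^T *m row a (g x).
have -> : (Ups 0 a)%:M + delta_mx a 0 *m Ups - (Ups *m h)^T *m row a (g x) = h *m E.
  rewrite /E mulmxBr mulmxDr trmx_mul trmx_inv gT -!mulmxA; congr (_ + _ - _).
    by rewrite -scalemxAr mulVmx // scalemx1.
  by rewrite mulmxA tr_row gT colE mulmxA mulVmx // mul1mx.
rewrite !levi_civitaE -mulmxDr /= invmxZ ?unitmxZ ?unitfE //.
rewrite (_ : (fun b => _) = (fun b => Om x ^+ 2 *: (D b g + (2 * Ups 0 b) *: g x))).
  by rewrite lowered_christoffel_conformal // -scalemxAl -scalemxAr scalerA mulVf ?scale1r.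
by apply/funext => b; exact: derive_conformal_metric.
Qed.

Variables (gp gm : 'I_n -> 'rV[K]_n -> 'M[K]_N) (cp cm : 'I_n -> 'M[K]_N).
Hypotheses (clp : clifford (g x) (gp^~ x) (gm^~ x)) (clm : clifford (g x) (gm^~ x) (gp^~ x)).
Hypothesis gp_parallel : forall a b, D a (gp b)
  - \sum_c levi_civita g x a c b *: gp c x + gp b x *m cm a - cp a *m gp b x = 0.
Hypothesis (diff_gp : forall a, differentiable_mx (gp a) x).
Let U := Ups *m h.

(** Up to the factor Om, differentiating Om adds Upsilon_a gamma_b, the Levi-Civita correction
    subtracts Upsilon_a gamma_b + Upsilon_b gamma_a - g_{ab} Upsilon^c gamma_c, and half of
    [weyl_commutator] restores the last two terms. *)
Lemma conformal_gamma_parallel a b :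
  D a (fun y => Om y *: gp b y)
  - \sum_c levi_civita (fun y => Om y ^+ 2 *: g y) x a c b *: (Om x *: gp c x)
  + (Om x *: gp b x) *m (cm a - 2^-1 *: (slash (gm^~ x) U *m gp a x))
  - (cp a - 2^-1 *: (slash (gp^~ x) U *m gm a x)) *m (Om x *: gp b x) = 0.
Proof.
have gu := metric_unit g_near.
have Ug : U *m g x = Ups by rewrite mulmxKV.
have sumE : \sum_c levi_civita (fun y => Om y ^+ 2 *: g y) x a c b *: (Om x *: gp c x)
    = Om x *: (\sum_c levi_civita g x a c b *: gp c x
      + (Ups 0 a *: gp b x + Ups 0 b *: gp a x - g x a b *: slash (gp^~ x) U)).
  rewrite levi_civita_conformal -/U.
  have entry c : ((Ups 0 a)%:M + delta_mx a 0 *m Ups - U^T *m row a (g x)) c b =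
      Ups 0 a * (c == b)%:R + Ups 0 b * (c == a)%:R - g x a b * U 0 c.
    rewrite [LHS]mxE [X in X + _]mxE [X in _ + X]mxE; congr (_ + _ - _).
    - by rewrite mxE mulr_natr.
    - by rewrite mxE big_ord1 mxE eqxx andbT mulrC.
    - by rewrite mxE big_ord1 mxE [row _ _ _ _]mxE mulrC.
  under eq_bigr do rewrite mxE entry scalerA mulrC -scalerA scalerDl.
  rewrite -scaler_sumr big_split /=; congr (_ *: (_ + _)).
  under eq_bigr do rewrite scalerBl scalerDl -!scalerA.
  rewrite sumrB big_split /= -!scaler_sumr; congr (_ *: _ + _ *: _ - _).
  - rewrite (bigD1 b) //= eqxx scale1r big1 ?addr0 // => c cb.
    by rewrite (negPf cb) scale0r.
  - rewrite (bigD1 a) //= eqxx scale1r big1 ?addr0 // => c ca.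
    by rewrite (negPf ca) scale0r.
have derE : D a (fun y => Om y *: gp b y) = Om x *: (Ups 0 a *: gp b x + D a (gp b)).
  by rewrite derive_mxZ // scalerDr scalerA mxE mulrA mulfV // mul1r.
rewrite sumE derE -!scalemxAl -!scalemxAr -scalerBr -scalerDr -scalerBr.
rewrite mulmxBr mulmxBl -scalemxAr -scalemxAl mulmxA.
have := weyl_commutator U a b clp clm; rewrite Ug; have := gp_parallel a b.
move: (D a (gp b)) (\sum_c _) (gp b x *m cm a) (cp a *m gp b x) => dg S T T'.
move: (slash _ U *m gm a x *m _) (gp b x *m _ *m _) => W W'.
move: (gp a x) (gp b x) (slash _ U) (Ups 0 a) (Ups 0 b) (g x a b) => A B V s t r.
move=> /(canRL (subrK _))/(canRL (addrK _))/(canRL (subrK _)) ->.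
move=> /(canRL (subrK _)) ->.
rewrite -[RHS](scaler0 _ (Om x)); congr (_ *: _).
apply/matrixP => i j; by rewrite !mxE; field.
Qed.

End ConformalRescaling.

(** * The spin connection of an orthonormal frame *)

Section OrthonormalFrame.
Variables (K : numFieldType) (n N : nat).
Implicit Types (a b c : 'I_n).
Variables (g e : 'rV[K]_n -> 'M[K]_n) (x : 'rV[K]_n).
Hypotheses (g_near : \forall y \near x, (g y)^T = g y /\ g y \in unitmx).
Hypotheses (diff_g : differentiable_mx g x) (diff_e : differentiable_mx e x).
Hypothesis e_near : \forall y \near x, e y *m g y *m (e y)^T = 1%:M.
Local Notation D a F := (derive_mx (delta_mx 0 a : 'rV[K]_n) F x).

(** The entry (b, k) is g_{bc} e_k^c; by orthonormality this is the inverse matrix of [e]. *)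
Let theta y := g y *m (e y)^T.

Let diff_eT : differentiable_mx (fun y => (e y)^T) x.
Proof. exact: differentiable_mx_tr. Qed.

Let diff_theta : differentiable_mx theta x. Proof. exact: differentiable_mxM. Qed.

Let e_theta y : e y *m g y *m (e y)^T = 1%:M -> theta y *m e y = 1%:M.
Proof. by rewrite -mulmxA => /mulmx1C. Qed.

(** This expression of g^-1 through the frame also shows that g^-1 is differentiable. *)
Lemma frame_inverse_metric : \forall y \near x, (e y)^T *m e y = invmx (g y).
Proof.
near=> y.
have [_ gu] : (g y)^T = g y /\ g y \in unitmx by near: y.
have /e_theta th : e y *m g y *m (e y)^T = 1%:M by near: y.
by apply: (can_inj (mulKmx gu)); rewrite mulmxA th mulmxV.
Unshelve. all: by end_near. Qed.

Lemma differentiable_inverse_metric : differentiable_mx (fun y => invmx (g y)) x.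
Proof. by apply: near_eq_differentiable_mx frame_inverse_metric _; exact: differentiable_mxM. Qed.

Definition frame_connection a : 'M[K]_n :=
  (D a e + e x *m (levi_civita g x a)^T) *m g x *m (e x)^T.

Let gT : (g x)^T = g x. Proof. exact: metric_sym. Qed.

(** Differentiate e g e^T = 1 and replace the derivative of g by metric compatibility. *)
Lemma frame_connection_skew a : (frame_connection a)^T = - frame_connection a.
Proof.
have : D a (fun y => e y *m theta y) = 0.
  rewrite -[RHS](derive_mx_cst (delta_mx 0 a) (1%:M : 'M[K]_n) x).
  by apply: near_eq_derive_mx; apply: filterS e_near => y; rewrite mulmxA.
rewrite derive_mxM // derive_mxM // derive_mx_tr (metric_compat g_near) => der0.
apply/eqP; rewrite -addr_eq0 addrC -[X in _ == X]der0; apply/eqP.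
rewrite /frame_connection /theta !trmx_mul linearD /= trmx_mul !trmxK gT.
rewrite !(mulmxDl, mulmxDr) !mulmxA -!addrA.
by congr (_ + (_ + _)); rewrite addrC.
Qed.

Variables (cp cm : 'I_n -> 'M[K]_N).
Let gp b y := \sum_k theta y b k *: cp k.

Lemma differentiable_mx_gamma b : differentiable_mx (gp b) x.
Proof.
apply: differentiable_mx_sum => k; apply: differentiable_mxZ; first exact: diff_theta.
exact: differentiable_mx_cst.
Qed.

Let gpE b y : gp b y = slash cp (row b (theta y)).
Proof. by apply: eq_bigr => k _; rewrite [row _ _ _ _]mxE. Qed.

Let derive_gp a b : D a (gp b) = slash cp (row b (D a theta)).
Proof.
rewrite derive_mx_sum; last first.
  move=> k; apply: differentiable_mxZ; first exact: diff_theta.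
  exact: differentiable_mx_cst.
apply: eq_bigr => k _; rewrite derive_mxZ; [|exact: diff_theta|]; last first.
  exact: differentiable_mx_cst.
by rewrite derive_mx_cst scaler0 addr0 mxE mxE.
Qed.

Hypotheses (clp : clifford 1%:M cp cm) (clm : clifford 1%:M cm cp).

(** The Levi-Civita derivative of [theta] is [theta x *m om^T]. By [spin_rotation] the spin
    connection contributes -1/4 times 4 times the same vector, and the two cancel. *)
Lemma frame_gamma_parallel a b (om := frame_connection a) :
  D a (gp b) - \sum_c levi_civita g x a c b *: gp c x
  + gp b x *m (- 4^-1 *: \sum_k \sum_l om k l *: (cm k *m cp l))
  - (- 4^-1 *: \sum_k \sum_l om k l *: (cp k *m cm l)) *m gp b x = 0.
Proof.
have e_th : theta x *m e x = 1%:M by apply: e_theta; exact: (nbhs_singleton e_near).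
have thetaE : D a theta - (levi_civita g x a)^T *m theta x = theta x *m om^T.
  rewrite derive_mxM // derive_mx_tr (metric_compat g_near) mulmxDl.
  rewrite -(mulmxA _ (g x) (e x)^T) -/(theta x) -[_ + _ + _]addrA [X in X - _]addrC addrK.
  rewrite /om /frame_connection trmx_mul trmxK trmx_mul gT.
  rewrite !mulmxA e_th mul1mx linearD /= trmx_mul trmxK mulmxDr mulmxA.
  by rewrite addrC.
have -> : \sum_c levi_civita g x a c b *: gp c x
    = slash cp (row b ((levi_civita g x a)^T *m theta x)).
  rewrite row_mul slash_mulmx_row; apply: eq_bigr => c _.
  by rewrite gpE !mxE.
rewrite derive_gp; have -> : slash cp (row b (D a theta)) =
    slash cp (row b ((levi_civita g x a)^T *m theta x))
    + slash cp (row b (theta x) *m om^T).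
  by rewrite -slashD -row_mul -thetaE -linearD /= addrC subrK.
rewrite [X in X - _ + _ - _]addrC addrK.
rewrite -scalemxAl -scalemxAr -addrA -scalerBr gpE (spin_rotation _ clp clm); last first.
  exact: frame_connection_skew.
by rewrite scalerA mulNr mulVf ?pnatr_eq0 // scaleN1r subrr.
Qed.

End OrthonormalFrame.

Lemma frame_clifford (K : numFieldType) n N (g e : 'M[K]_n) (cp cm : 'I_n -> 'M[K]_N) :
  g^T = g -> e *m g *m e^T = 1%:M -> clifford 1%:M cp cm ->
  clifford g (fun a => \sum_k (g *m e^T) a k *: cp k) (fun a => \sum_k (g *m e^T) a k *: cm k).
Proof.
move=> gT ge cl.
have eg : g *m e^T *m e = 1%:M by move: ge; rewrite -mulmxA => /mulmx1C.
have : g *m e^T *m (g *m e^T)^T = g by rewrite trmx_mul trmxK gT mulmxA eg mul1mx.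
move: (g *m e^T) => t tt a b.
have slE (f : 'I_n -> 'M[K]_N) c : \sum_k t c k *: f k = slash f (row c t).
  by apply: eq_bigr => k _; rewrite mxE.
rewrite !slE (slash_clifford _ _ cl) mulmx1 -[in RHS]tt; congr (- 2 * _)%:M.
by rewrite !mxE; apply: eq_bigr => k _; rewrite !mxE.
Qed.

(** * Conformal variation of the tensors built from a pure spinor *)

Section ConformalVariation.
Variables (K : numFieldType) (n N : nat) (g h : 'M[K]_n) (gp gm : 'I_n -> 'M[K]_N).
Hypotheses (gT : g^T = g) (gh : g *m h = 1%:M).
Hypotheses (clp : clifford g gp gm) (clm : clifford g gm gp).
Variables (xi : 'rV[K]_N) (p : 'I_n -> 'rV[K]_N) (u : 'rV[K]_n) (s : K).
Hypothesis contr0 : \sum_b (xi *m slash gp (row b h))^T *m (xi *m gp b) = 0.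
Hypothesis s0 : s != 0.
Implicit Types (a b : 'I_n) (A B D : 'I_N).

(** Here [p] stands for nabla xi, [u] for Upsilon with raised index and [s] for Om; then z =
    Upsilon_c xi^c, and [p'] is the rescaled derivative of xi. *)
Let z := xi *m slash gp u.
Let L a := xi *m gp a.
Let U a := xi *m slash gp (row a h).
Let p' a := p a - 2^-1 *: (z *m gm a).

Let two0 : (2 : K) != 0. Proof. by rewrite pnatr_eq0. Qed.

Let outerE (v w : 'rV[K]_N) A B : (v^T *m w) A B = v 0 A * w 0 B.
Proof. by rewrite !mxE big_ord1 !mxE. Qed.

Let outer_sumE (I : finType) (v w : I -> 'rV[K]_N) A B :
  (\sum_i (v i)^T *m w i) A B = \sum_i v i 0 A * w i 0 B.
Proof. by rewrite summxE; apply: eq_bigr => i _; exact: outerE. Qed.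

Let cancel_scale (x y : K) : (s^-1 * x) * (s * y) = x * y.
Proof. by rewrite mulrACA mulVf // mul1r. Qed.

Lemma contraction_entry A B : \sum_b U b 0 A * L b 0 B = 0.
Proof. by rewrite -outer_sumE contr0 mxE. Qed.

Definition nabla_tensor (q : 'I_n -> 'rV[K]_N) a B D : K :=
  \sum_b (q a *m slash gp (row b h)) 0 B * L b 0 D.

(** The correction is half of [contraction_weyl]; the weights s^-1 of xi^b and s of xi_b cancel. *)
Lemma nabla_tensor_rescaled a B D :
  \sum_b (s^-1 *: (p' a *m slash gp (row b h))) 0 B * (s *: L b) 0 D =
  nabla_tensor p a B D - (L a 0 B * z 0 D - z 0 B * L a 0 D).
Proof.
transitivity ((\sum_b (p' a *m slash gp (row b h))^T *m L b) B D).
  rewrite outer_sumE; apply: eq_bigr => b _.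
  by rewrite [X in X * _]mxE [X in _ * X]mxE cancel_scale.
have -> : \sum_b (p' a *m slash gp (row b h))^T *m L b =
    \sum_b (p a *m slash gp (row b h))^T *m L b - ((L a)^T *m z - z^T *m L a).
  under eq_bigr do rewrite mulmxBl linearB /= mulmxBl -scalemxAl linearZ /= -scalemxAl.
  rewrite sumrB -scaler_sumr (contraction_weyl gT gh clp clm contr0).
  by rewrite scalerA mulVf // scale1r.
by rewrite [LHS]mxE outer_sumE [X in _ + X]mxE [X in - X]mxE [X in _ - (_ + X)]mxE !outerE.
Qed.

(** Both correction terms contain xi^a (x) xi_a, which vanishes. The contracted tensor is thus
    merely scaled, and so is every symmetrisation of it. *)
Lemma contracted_nabla_rescaled A B D :
  \sum_a (s^-1 *: U a) 0 A * (nabla_tensor p a B D - (L a 0 B * z 0 D - z 0 B * L a 0 D)) =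
  s^-1 * \sum_a U a 0 A * nabla_tensor p a B D.
Proof.
under eq_bigr do rewrite mxE -mulrA.
rewrite -mulr_sumr; congr (_ * _).
transitivity (\sum_a (U a 0 A * nabla_tensor p a B D - (U a 0 A * L a 0 B) * z 0 D
   + (U a 0 A * L a 0 D) * z 0 B)).
  by apply: eq_bigr => a _; ring.
by rewrite big_split sumrB /= -!mulr_suml !contraction_entry !mul0r subr0 addr0.
Qed.

(** Since gamma_b gamma^b = - 2 m, the correction - 1/2 z gamma_b gamma^b is m z. *)
Lemma divergence_rescaled m : n = (2 * m)%N ->
  \sum_b s^-1 *: (p' b *m slash gp (row b h)) =
  s^-1 *: (\sum_b p b *m slash gp (row b h) + m%:R *: z).
Proof.
move=> n2m; rewrite -scaler_sumr; congr (_ *: _).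
under eq_bigr do rewrite mulmxBl -scalemxAl -mulmxA.
rewrite sumrB -scaler_sumr -mulmx_sumr (clifford_trace gT gh clm) mul_mx_scalar.
have half : 2^-1 * n%:R = m%:R :> K by rewrite n2m natrM mulKf.
by rewrite scalerA mulrN half scaleNr opprK.
Qed.

(** By [contraction_weyl_spinor] the correction to xi^b (x) nabla_b xi is z (x) xi; multiplication
    by gamma_a makes it z (x) xi_a. *)
Lemma transport_low_rescaled a B D :
  \sum_b (s^-1 *: U b) 0 B * (s *: (p' b *m gp a)) 0 D =
  \sum_b U b 0 B * (p b *m gp a) 0 D + z 0 B * L a 0 D.
Proof.
under eq_bigr do rewrite [X in X * _]mxE [X in _ * X]mxE cancel_scale.
rewrite -outer_sumE; under eq_bigr do rewrite mulmxA mulmxBr -scalemxAr.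
rewrite -mulmx_suml sumrB -scaler_sumr (contraction_weyl_spinor gh clp contr0).
rewrite scalerA mulrN mulVf // scaleN1r opprK mulmxDl mxE -mulmxA outerE; congr (_ + _).
by rewrite mulmx_suml summxE; apply: eq_bigr => b _; rewrite -mulmxA outerE.
Qed.

Lemma transport_rescaled A B :
  \sum_b (s^-1 *: U b) 0 B * p' b 0 A = s^-1 * (\sum_b U b 0 B * p b 0 A + z 0 B * xi 0 A).
Proof.
under eq_bigr do rewrite mxE -mulrA.
rewrite -mulr_sumr; congr (_ * _).
rewrite -outer_sumE; under eq_bigr do rewrite mulmxBr -scalemxAr.
rewrite sumrB -scaler_sumr (contraction_weyl_spinor gh clp contr0).
by rewrite scalerA mulrN mulVf // scaleN1r opprK mxE outer_sumE outerE.
Qed.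

End ConformalVariation.

(** * Spin geometries in a chart *)

Lemma slash_rescaled (K : numFieldType) n N (g : 'M[K]_n) (gp : 'I_n -> 'M[K]_N) (s : K) a :
  s != 0 -> g \in unitmx ->
  slash (fun c => s *: gp c) (row a (invmx (s ^+ 2 *: g))) =
  s^-1 *: slash gp (row a (invmx g)).
Proof.
move=> s0 gu; rewrite invmxZ ?unitmxZ ?unitfE ?expf_neq0 // /slash scaler_sumr.
apply: eq_bigr => c _; rewrite !mxE !scalerA; congr (_ *: _).
by field.
Qed.

Lemma clifford_rescaled (K : numFieldType) n N (g : 'M[K]_n) (f k : 'I_n -> 'M[K]_N) (s : K) :
  clifford g f k -> clifford (s ^+ 2 *: g) (fun a => s *: f a) (fun a => s *: k a).
Proof.
move=> cl a b; rewrite -!scalemxAl -!scalemxAr !scalerA -scalerDr cl scale_scalar_mx mxE.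
by congr (_%:M); ring.
Qed.

(** The facts at x on which the tensor computations rest. Induced geometries have them and rescaling
    preserves them, so the formulas for covariant derivatives hold before and after rescaling. *)
Record regular_at (R : realType) n N (G : spin_geometry R n N) (x : 'rV[CC R]_n) : Prop := {
  regular_met : \forall y \near x, (met G y)^T = met G y /\ met G y \in unitmx;
  regular_diff_met : differentiable_mx (met G) x;
  regular_diff_inv : differentiable_mx (fun y => invmx (met G y)) x;
  regular_diff_gamp : forall a, differentiable_mx (gamp G a) x;
  regular_clp : clifford (met G x) (gamp G ^~ x) (gamm G ^~ x);
  regular_clm : clifford (met G x) (gamm G ^~ x) (gamp G ^~ x);
  regular_parallel : forall a b,
    derive_mx (delta_mx 0 a : 'rV[CC R]_n) (gamp G b) x
    - \sum_c levi_civita (met G) x a c b *: gamp G c x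
    + gamp G b x *m conm G a x - conp G a x *m gamp G b x = 0
}.

Lemma christoffelE (R : realType) n (g : 'rV[CC R]_n -> 'M[CC R]_n) x a b c :
  christoffel g b a c x = levi_civita g x a b c.
Proof. by apply: esym; exact: mxE. Qed.

(** * Covariant derivatives of xi_b and xi^b through that of xi *)

Section CovariantDerivatives.
Variables (R : realType) (n N : nat) (G : spin_geometry R n N).
Local Notation C := (CC R).
Variables (xi : 'rV[C]_n -> 'rV[C]_N) (x : 'rV[C]_n).
Hypotheses (rG : regular_at G x) (hxi : holo_mx xi x).
Local Notation gp := (gamp G ^~ x).
Local Notation h := (invmx (met G x)).

Lemma slash_rowE (f : 'I_n -> 'M[C]_N) b : slash f (row b h) = \sum_c h b c *: f c.
Proof. by apply: eq_bigr => c _; congr (_ *: _); exact: mxE. Qed.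

Lemma xi_upE b : xi_up G xi b x = xi x *m slash gp (row b h).
Proof.
apply: etrans (congr1 (mulmx (xi x)) (esym (slash_rowE gp b))).
apply: etrans _ (esym (mulmx_sumr _ _ _ _)).
by apply: eq_bigr => c _; exact: scalemxAr.
Qed.

Lemma nabla_xi_lowE a b : nabla_xi_low G xi a b x = nabla_xi G xi a x *m gamp G b x.
Proof.
apply: etrans (nabla_low_parallel (regular_parallel rG) (regular_diff_gamp rG) hxi a b).
congr (_ - _ + _); apply: eq_bigr => c _; congr (_ *: _); exact: christoffelE.
Qed.

Lemma nabla_xi_upE a b :
  nabla_xi_up G xi a b x = nabla_xi G xi a x *m slash gp (row b h).
Proof.
apply: etrans (congr1 (mulmx _) (esym (slash_rowE gp b))).
apply: etrans (nabla_up_parallel (regular_met rG) (regular_diff_met rG)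
  (regular_diff_inv rG) (regular_parallel rG) (regular_diff_gamp rG) hxi a b).
congr (_ + _ + _); apply: eq_bigr => c _; congr (_ *: _); exact: christoffelE.
Qed.

End CovariantDerivatives.

(** * Regularity of the rescaled geometry *)

Section ConformalGeometry.
Variables (R : realType) (n N : nat) (G : spin_geometry R n N).
Local Notation C := (CC R).
Variables (x : 'rV[C]_n) (Om : 'rV[C]_n -> C).
Hypotheses (rG : regular_at G x) (Om0 : forall y, Om y != 0) (hOm : holo Om x).
Local Notation gp := (gamp G ^~ x).
Local Notation gm := (gamm G ^~ x).
Local Notation h := (invmx (met G x)).
Local Notation G' := (conformal Om G).

Definition log_gradient : 'rV[C]_n := \row_b ((Om x)^-1 * pd b Om x).
Local Notation Ups := log_gradient.

Let log_gradientE b : Ups 0 b = (Om x)^-1 * pd b Om x. Proof. exact: mxE. Qed.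

Lemma conformal_conp a :
  conp G' a x = conp G a x - 2^-1 *: (slash gp (Ups *m h) *m gamm G a x).
Proof.
congr (_ - 2^-1 *: _); apply: etrans; last by rewrite slash_mulmx_row mulmx_suml.
apply: eq_bigr => b _; apply: etrans (scalemxAl _ _ _) _; congr (_ *m _).
apply: etrans (congr1 _ (esym (slash_rowE G x gp b))) _.
by congr (_ *: _); rewrite log_gradientE.
Qed.

Lemma conformal_conm a :
  conm G' a x = conm G a x - 2^-1 *: (slash gm (Ups *m h) *m gamp G a x).
Proof.
congr (_ - 2^-1 *: _); apply: etrans; last by rewrite slash_mulmx_row mulmx_suml.
apply: eq_bigr => b _; apply: etrans (scalemxAl _ _ _) _; congr (_ *m _).
apply: etrans (congr1 _ (esym (slash_rowE G x gm b))) _.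
by congr (_ *: _); rewrite log_gradientE.
Qed.

Let diff_Om2 : differentiable (fun y => Om y ^+ 2) x.
Proof.
have -> : (fun y => Om y ^+ 2) = (fun y => Om y * Om y).
  by apply/funext => y; exact: expr2.
exact: differentiableM.
Qed.

Lemma conformal_regular : regular_at G' x.
Proof.
split.
- near=> y.
  have [sy uy] : (met G y)^T = met G y /\ met G y \in unitmx.
    by near: y; exact: regular_met rG.
  split; first by apply: etrans (linearZ _ _) _; congr (_ *: _).
  by rewrite unitmxZ // unitfE expf_neq0.
- exact: differentiable_mxZ diff_Om2 (regular_diff_met rG).
- have diff_inv2 : differentiable (fun y => (Om y ^+ 2)^-1) x.
    by apply: differentiableV diff_Om2 _; rewrite expf_neq0.
  apply: near_eq_differentiable_mx (differentiable_mxZ diff_inv2 (regular_diff_inv rG)).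
  near=> y.
  have [sy uy] : (met G y)^T = met G y /\ met G y \in unitmx.
    by near: y; exact: regular_met rG.
  by apply/esym/invmxZ; rewrite unitmxZ // unitfE expf_neq0.
- by move=> a; exact: differentiable_mxZ hOm (regular_diff_gamp rG a).
- exact: (clifford_rescaled (Om x) (regular_clp rG)).
- exact: (clifford_rescaled (Om x) (regular_clm rG)).
- move=> a b; rewrite conformal_conp conformal_conm.
  exact (conformal_gamma_parallel (regular_met rG) (regular_diff_met rG) hOm (Om0 x)
    (regular_clp rG) (regular_clm rG) (regular_parallel rG) (regular_diff_gamp rG) a b).
Unshelve. all: by end_near. Qed.

End ConformalGeometry.

Lemma cdom_open (R : realType) n (M : complex_manifold R n) (i : idx M) : open (cdom i).
Proof.
by case: M i => M haus count I d c p cov op_d op_c *; exact: op_c.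
Qed.

Lemma spin_manifoldP (R : realType) m (S : clifford_module R m) (X : spin_manifold S)
    (i : idx X) x : cdom i x ->
  [/\ holo_mx (metric i) x, (metric i x)^T = metric i x, metric i x \in unitmx,
      holo_mx (frame i) x & frame i x *m metric i x *m (frame i x)^T = 1%:M].
Proof.
by case: X i => X g g_holo g_sym g_unit g_jac e e_holo e_orth *; split; auto.
Qed.

Lemma connection_entry (K : fieldType) n (E e G g : 'M[K]_n) k l :
  \sum_b \sum_c (E k b + \sum_d G b d * e k d) * g b c * e l c =
  ((E + e *m G^T) *m g *m e^T) k l.
Proof.
rewrite exchange_big mxE; apply: eq_bigr => c _.
rewrite !mxE mulr_suml; apply: eq_bigr => b _; rewrite !mxE.
by congr ((_ + _) * _ * _); apply: eq_bigr => d _; rewrite mxE mulrC.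
Qed.

(** * Regularity of the geometry induced by the spin structure *)

Section InducedRegular.
Variables (R : realType) (m : nat) (S : clifford_module R m).
Variables (X : spin_manifold S) (i : idx X).
Local Notation C := (CC R).
Local Notation n := (2 * m)%N.
Local Notation g := (metric i).
Local Notation e := (frame i).
Local Notation G := (induced_geometry i).

Lemma clifford_module_clifford :
  clifford 1%:M (cgp S) (cgm S) /\ clifford 1%:M (cgm S) (cgp S).
Proof.
have two0 : (2 : C) != 0 by rewrite pnatr_eq0.
case: S => cp cm hp hm.
by split=> k l; apply: (scalerI (invr_neq0 two0)); [rewrite hp|rewrite hm];
  rewrite scale_scalar_mx mxE mulrA mulrN mulVf // mulN1r.
Qed.

Lemma spin_omegaE a k l x : spin_omega i a k l x = frame_connection g e x a k l.
Proof.
apply: etrans _ (connection_entry _ _ _ _ k l).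
apply: eq_bigr => b _; apply: eq_bigr => c _; congr (_ * _ * _).
congr (_ + _); first by apply: esym; exact: mxE.
by apply: eq_bigr => d _; congr (_ * _); exact: christoffelE.
Qed.

Lemma induced_conp a x : conp G a x = - 4^-1 *:
  \sum_k \sum_l frame_connection g e x a k l *: (cgp S k *m cgm S l).
Proof.
congr (_ *: _); apply: eq_bigr => k _; apply: eq_bigr => l _; congr (_ *: _).
exact: spin_omegaE.
Qed.

Lemma induced_conm a x : conm G a x = - 4^-1 *:
  \sum_k \sum_l frame_connection g e x a k l *: (cgm S k *m cgp S l).
Proof.
congr (_ *: _); apply: eq_bigr => k _; apply: eq_bigr => l _; congr (_ *: _).
exact: spin_omegaE.
Qed.

Lemma induced_regular x : cdom i x -> regular_at G x.
Proof.
move=> ix.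
(* Chart images are open, so the pointwise axioms hold on a neighbourhood of x, where they can be
   differentiated. *)
have near_cdom : \forall y \near x, cdom i y.
  by apply: open_nbhs_nbhs; split; first exact: cdom_open.
have [hg _ _ he _] := spin_manifoldP ix.
have g_near : \forall y \near x, (g y)^T = g y /\ g y \in unitmx.
  by apply: filterS near_cdom => y /spin_manifoldP[].
have e_near : \forall y \near x, e y *m g y *m (e y)^T = 1%:M.
  by apply: filterS near_cdom => y /spin_manifoldP[].
have [gT ge] : (g x)^T = g x /\ e x *m g x *m (e x)^T = 1%:M.
  by have [] := spin_manifoldP ix.
have [clp clm] := clifford_module_clifford.
split.
- exact: g_near.
- exact: hg.
- exact: differentiable_inverse_metric g_near he e_near.
- by move=> a; exact: differentiable_mx_gamma hg he _ a.
- exact: (frame_clifford gT ge clp).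
- exact: (frame_clifford gT ge clm).
- move=> a b; rewrite induced_conp induced_conm.
  exact (frame_gamma_parallel g_near hg he e_near clp clm a b).
Qed.

End InducedRegular.

(** * Each tensor of the conditions under rescaling *)

Section Variation.
Variables (R : realType) (n N m : nat) (G : spin_geometry R n N).
Local Notation C := (CC R).
Variables (xi : 'rV[C]_n -> 'rV[C]_N) (x : 'rV[C]_n) (Om : 'rV[C]_n -> C).
Hypotheses (rG : regular_at G x) (hxi : holo_mx xi x) (xi0 : xi x != 0).
Hypotheses (pure_xi : pure_at G xi m x) (n2m : n = (2 * m)%N).
Hypotheses (Om0 : forall y, Om y != 0) (hOm : holo Om x).
Local Notation gp := (gamp G ^~ x).
Local Notation gm := (gamm G ^~ x).
Local Notation h := (invmx (met G x)).
Local Notation G' := (conformal Om G).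

Let gT : (met G x)^T = met G x. Proof. exact: metric_sym (regular_met rG). Qed.
Let gu : met G x \in unitmx. Proof. exact: metric_unit (regular_met rG). Qed.
Let gh : met G x *m h = 1%:M. Proof. exact: mulmxV. Qed.
Let clp := regular_clp rG.
Let clm := regular_clm rG.
Let rG' : regular_at G' x. Proof. exact: conformal_regular. Qed.
Let s0 : Om x != 0. Proof. exact: Om0. Qed.

Lemma pure_at_contraction :
  \sum_b (xi x *m slash gp (row b h))^T *m (xi x *m gp b) = 0.
Proof.
rewrite -(contraction_sum gp gT gh).
exact: (pure_contraction gh clp n2m xi0 pure_xi).
Qed.
Let contr0 := pure_at_contraction.

Let u := log_gradient x Om *m h.
Let z := xi x *m slash gp u.
Let p a := nabla_xi G xi a x.
Let p' a := p a - 2^-1 *: (z *m gm a).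
Let T := nabla_tensor h gp (xi x).

Lemma conformal_nabla_xi a : nabla_xi G' xi a x = p' a.
Proof.
apply: etrans (congr1 (fun M => _ + xi x *m M) (conformal_conp G x Om a)) _.
by rewrite mulmxBr -scalemxAr addrA mulmxA.
Qed.

Lemma conformal_xi_low a : xi_low G' xi a x = Om x *: xi_low G xi a x.
Proof. by apply: esym; exact: scalemxAr. Qed.

Lemma conformal_xi_up a : xi_up G' xi a x = (Om x)^-1 *: (xi x *m slash gp (row a h)).
Proof.
apply: etrans (xi_upE G' xi x a) _.
by apply: etrans (congr1 _ (slash_rescaled gp a s0 gu)) _; rewrite scalemxAr.
Qed.

Lemma conformal_nabla_xi_up a b :
  nabla_xi_up G' xi a b x = (Om x)^-1 *: (p' a *m slash gp (row b h)).
Proof.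
apply: etrans (nabla_xi_upE rG' hxi a b) _.
apply: etrans (congr1 (mulmx^~ _) (conformal_nabla_xi a)) _.
by apply: etrans (congr1 _ (slash_rescaled gp b s0 gu)) _; rewrite scalemxAr.
Qed.

Lemma conformal_nabla_xi_low a b :
  nabla_xi_low G' xi a b x = Om x *: (p' a *m gamp G b x).
Proof.
apply: etrans (nabla_xi_lowE rG' hxi a b) _.
apply: etrans (congr1 (mulmx^~ _) (conformal_nabla_xi a)) _.
by apply: esym; exact: scalemxAr.
Qed.

Lemma nabla_xi_xiE a B D : nabla_xi_xi G xi a x B D = T p a B D.
Proof.
apply: eq_bigr => b _; congr (_ * _).
exact (congr1 (fun v : 'rV[C]_N => v 0 B) (nabla_xi_upE rG hxi a b)).
Qed.

Lemma conformal_nabla_tensor a B D : nabla_xi_xi G' xi a x B D = T p' a B D.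
Proof.
apply: eq_bigr => b _.
refine (etrans (congr2 (fun v w : 'rV[C]_N => v 0 B * w 0 D)
  (conformal_nabla_xi_up a b) (conformal_xi_low b)) _).
by rewrite [X in X * _]mxE [X in _ * X]mxE mulrACA mulVf // mul1r.
Qed.

Lemma conformal_nabla_xi_xi a B D : nabla_xi_xi G' xi a x B D =
  T p a B D - (xi_low G xi a x 0 B * z 0 D - z 0 B * xi_low G xi a x 0 D).
Proof.
apply: etrans _ (nabla_tensor_rescaled gT gh clp clm p u contr0 s0 a B D).
apply: eq_bigr => b _.
exact (congr2 (fun v w : 'rV[C]_N => v 0 B * w 0 D)
  (conformal_nabla_xi_up a b) (conformal_xi_low b)).
Qed.

Lemma conformal_xi_nabla_xi_xi A B D :
  xi_nabla_xi_xi G' xi x A B D = (Om x)^-1 * xi_nabla_xi_xi G xi x A B D.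
Proof.
apply: etrans _ (etrans (contracted_nabla_rescaled p u (Om x) contr0 A B D) _).
  apply: eq_bigr => a _; congr (_ * _); last exact: conformal_nabla_xi_xi.
  exact (congr1 (fun v : 'rV[C]_N => v 0 A) (conformal_xi_up a)).
congr (_ * _); apply: eq_bigr => a _; congr (_ * _); last by apply: esym; exact: nabla_xi_xiE.
apply: esym; exact (congr1 (fun v : 'rV[C]_N => v 0 A) (xi_upE G xi x a)).
Qed.

Lemma conformal_div_xi :
  div_xi G' xi x = (Om x)^-1 *: (div_xi G xi x + m%:R *: z).
Proof.
apply: etrans _ (etrans (divergence_rescaled gT gh clm (xi x) p u (Om x) n2m) _).
  by apply: eq_bigr => b _; exact: conformal_nabla_xi_up.
congr (_ *: (_ + _)); apply: eq_bigr => b _; apply: esym; exact: nabla_xi_upE.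
Qed.

Lemma conformal_transport_low a B D :
  \sum_b xi_up G' xi b x 0 B * nabla_xi_low G' xi b a x 0 D =
  \sum_b xi_up G xi b x 0 B * nabla_xi_low G xi b a x 0 D
  + z 0 B * xi_low G xi a x 0 D.
Proof.
apply: etrans _ (etrans (transport_low_rescaled gh clp p u contr0 s0 a B D) _).
  apply: eq_bigr => b _; congr (_ * _).
    exact (congr1 (fun v : 'rV[C]_N => v 0 B) (conformal_xi_up b)).
  exact (congr1 (fun v : 'rV[C]_N => v 0 D) (conformal_nabla_xi_low b a)).
congr (_ + _); apply: eq_bigr => b _; congr (_ * _); apply: esym.
  exact (congr1 (fun v : 'rV[C]_N => v 0 B) (xi_upE G xi x b)).
exact (congr1 (fun v : 'rV[C]_N => v 0 D) (nabla_xi_lowE rG hxi b a)).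
Qed.

Lemma conformal_transport A B :
  \sum_b xi_up G' xi b x 0 B * nabla_xi G' xi b x 0 A =
  (Om x)^-1 * (\sum_b xi_up G xi b x 0 B * nabla_xi G xi b x 0 A + z 0 B * xi x 0 A).
Proof.
apply: etrans _ (etrans (transport_rescaled gh clp p u (Om x) contr0 A B) _).
  apply: eq_bigr => b _; congr (_ * _).
    exact (congr1 (fun v : 'rV[C]_N => v 0 B) (conformal_xi_up b)).
  exact (congr1 (fun v : 'rV[C]_N => v 0 A) (conformal_nabla_xi b)).
congr (_ * (_ + _)); apply: eq_bigr => b _; congr (_ * _); apply: esym.
exact (congr1 (fun v : 'rV[C]_N => v 0 B) (xi_upE G xi x b)).
Qed.

End Variation.

(** * The conditions at a point *)

Lemma skew3_scale (K : fieldType) (s t1 t2 t3 t4 t5 t6 : K) :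
  6^-1 * (s * t1 + s * t2 + s * t3 - s * t4 - s * t5 - s * t6) =
  s * (6^-1 * (t1 + t2 + t3 - t4 - t5 - t6)).
Proof. by ring. Qed.

Lemma symm2_scale (K : fieldType) (s t1 t2 : K) :
  2^-1 * (s * t1 + s * t2) = s * (2^-1 * (t1 + t2)).
Proof. by ring. Qed.

(* Entries at fixed a: N = (nabla_a xi^b) xi_b, l = xi_a, d = nabla_b xi^b,
   t = xi^b nabla_b xi_a, z = Upsilon_b xi^b; primes denote the rescaled objects. *)
Lemma condition_c_identity (K : numFieldType)
    (N N' lB lB' lD lD' dB dB' dD dD' tB tB' tD tD' zB zD s k : K) :
  s != 0 -> k - 1 != 0 ->
  N' = N - (lB * zD - zB * lD) -> lB' = s * lB -> lD' = s * lD ->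
  dB' = s^-1 * (dB + k * zB) -> dD' = s^-1 * (dD + k * zD) ->
  tB' = tB + zB * lD -> tD' = tD + zD * lB ->
  N' + 2 / (k - 1) * (2^-1 * (lB' * dD' - lD' * dB') + 2^-1 * (tB' - tD')) =
  N + 2 / (k - 1) * (2^-1 * (lB * dD - lD * dB) + 2^-1 * (tB - tD)).
Proof. by move=> s0 k0 -> -> -> -> -> -> ->; field; rewrite s0 k0. Qed.

(** The divergence changes by k z and the transport term by z (x) xi; the surplus (k - 1) xi (x) z
    is exactly what the hypothesis on f removes when z is xi^b d_b f. *)
Lemma condition_f_identity (K : numFieldType) (xA dB dB' t t' zB w s k : K) :
  s != 0 -> dB' = s^-1 * (dB + k * zB) -> t' = s^-1 * (t + zB * xA) -> zB = w ->
  xA * dB - t = - (k - 1) * (xA * w) -> xA * dB' - t' = 0.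
Proof.
move=> s0 -> -> -> /(canRL (subrK _)) e.
rewrite mulrCA -mulrBr [xA * _]mulrDr e; rewrite (_ : _ - _ = 0) ?mulr0 //; ring.
Qed.

(** Both conditions say that q_a is a multiple of xi: the first by [pure_spinor_line] and the purity
    contraction, the second by elementary algebra. *)
Lemma parallel_tensor (K : numFieldType) n N m (g : 'M[K]_n) (gp gm : 'I_n -> 'M[K]_N)
    (xi : 'rV[K]_N) (q : 'I_n -> 'rV[K]_N) a :
  g^T = g -> g \in unitmx -> clifford g gp gm -> clifford g gm gp ->
  n = (2 * m)%N -> (N + N = 2 ^ m)%N -> xi != 0 ->
  \rank (kermx (\matrix_a (xi *m gp a))) = m ->
  (forall B D, nabla_tensor (invmx g) gp xi q a B D = 0) <->
  (forall B D, 2^-1 * (q a 0 B * xi 0 D - q a 0 D * xi 0 B) = 0).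
Proof.
move=> gT gu clp clm n2m dimN xi0 pure; split=> [par B D|skew B D].
  have [|c ->] := pure_spinor_line gT gu clp clm n2m dimN xi0 pure (p := q a).
    apply/matrixP => i j; rewrite [RHS]mxE -[RHS](par i j) summxE.
    by apply: eq_bigr => b _; rewrite mxE big_ord1 mxE.
  by rewrite !mxE; ring.
(* A nonzero coordinate of xi determines the factor of proportionality. *)
have /rV0Pn[k xik] := xi0.
have qE : q a = (q a 0 k / xi 0 k) *: xi.
  apply/rowP => j; rewrite mxE mulrAC; apply: (canRL (mulfK xik)).
  apply/eqP; rewrite -subr_eq0; have /eqP := skew j k.
  by rewrite mulf_eq0 invr_eq0 pnatr_eq0.
have contr0 : \sum_b (xi *m slash gp (row b (invmx g)))^T *m (xi *m gp b) = 0.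
  rewrite -(contraction_sum gp gT (mulmxV gu)).
  exact (pure_contraction (mulmxV gu) clp n2m xi0 pure).
rewrite /nabla_tensor qE; under eq_bigr do rewrite -scalemxAl mxE -mulrA.
by rewrite -mulr_sumr contraction_entry ?mulr0.
Qed.

(** The relation xi^b nabla_b xi = (nabla_b xi^b) xi survives multiplication by a matrix; with M =
    gamma_a it describes xi^b nabla_b xi_a. *)
Lemma parallel_transport_slash (K : fieldType) n N (U p : 'I_n -> 'rV[K]_N) (d xi : 'rV[K]_N)
    (M : 'M[K]_N) :
  (forall A B, xi 0 A * d 0 B - \sum_b U b 0 B * p b 0 A = 0) ->
  forall B D, \sum_b U b 0 B * (p b *m M) 0 D = d 0 B * (xi *m M) 0 D.
Proof.
move=> e B D; rewrite mxE mulr_sumr; under eq_bigr do rewrite mxE mulr_sumr.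
rewrite exchange_big; apply: eq_bigr => A _.
under eq_bigr do rewrite mulrA; rewrite -mulr_suml mulrA; congr (_ * _).
by apply/esym/eqP; rewrite mulrC -subr_eq0; apply/eqP.
Qed.

Lemma condition_c_vanishing (K : fieldType) (N c lB lD dB dD tB tD : K) :
  tB = dB * lD -> tD = dD * lB ->
  N + c * (2^-1 * (lB * dD - lD * dB) + 2^-1 * (tB - tD)) = 0 -> N = 0.
Proof. by move=> -> -> e; rewrite -e; ring. Qed.

Section PointwiseConditions.
Variables (R : realType) (n N m : nat) (G : spin_geometry R n N).
Local Notation C := (CC R).
Variables (xi : 'rV[C]_n -> 'rV[C]_N) (x : 'rV[C]_n) (Om : 'rV[C]_n -> C).
Hypotheses (rG : regular_at G x) (hxi : holo_mx xi x) (xi0 : xi x != 0).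
Hypotheses (pure_xi : pure_at G xi m x) (n2m : n = (2 * m)%N) (m1 : (1 < m)%N).
Hypotheses (Om0 : forall y, Om y != 0) (hOm : holo Om x).
Local Notation G' := (conformal Om G).
Local Notation z := (xi x *m slash (gamp G ^~ x) (log_gradient x Om *m invmx (met G x))).

Let s0 : Om x != 0. Proof. exact: Om0. Qed.

Let tE A B D :
  xi_nabla_xi_xi G' xi x A B D = (Om x)^-1 * xi_nabla_xi_xi G xi x A B D.
Proof. exact: conformal_xi_nabla_xi_xi rG hxi xi0 pure_xi n2m Om0 hOm A B D. Qed.

Let skew3E A B D : skew3 (xi_nabla_xi_xi G' xi x) A B D =
  (Om x)^-1 * skew3 (xi_nabla_xi_xi G xi x) A B D.
Proof.
move: tE; rewrite /skew3; move: (xi_nabla_xi_xi G' xi x) (xi_nabla_xi_xi G xi x) => t' t e.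
by rewrite !e; exact: skew3_scale.
Qed.

Lemma condition_a_conformal : condition_a G xi x <-> condition_a G' xi x.
Proof.
split=> ca A B D; first by apply: etrans (skew3E A B D) _; rewrite ca mulr0.
have := skew3E A B D; rewrite ca => /esym/eqP.
by rewrite mulf_eq0 invr_eq0 (negPf s0) => /eqP.
Qed.

Let symm2E A B D : symm2 (fun A' B' => xi_nabla_xi_xi G' xi x A' B' D) A B =
  (Om x)^-1 * symm2 (fun A' B' => xi_nabla_xi_xi G xi x A' B' D) A B.
Proof.
move: tE; rewrite /symm2; move: (xi_nabla_xi_xi G' xi x) (xi_nabla_xi_xi G xi x) => t' t e.
by rewrite !e; exact: symm2_scale.
Qed.

Lemma condition_b_conformal : condition_b G xi x <-> condition_b G' xi x.
Proof.
split=> cb A B D; first by apply: etrans (symm2E A B D) _; rewrite cb mulr0.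
have := symm2E A B D; rewrite cb => /esym/eqP.
by rewrite mulf_eq0 invr_eq0 (negPf s0) => /eqP.
Qed.

Let low_entry a B : xi_low G' xi a x 0 B = Om x * xi_low G xi a x 0 B.
Proof.
exact (etrans (congr1 (fun v : 'rV[C]_N => v 0 B) (conformal_xi_low G xi x Om a)) (mxE _ _ _ _)).
Qed.

Let div_entry B : div_xi G' xi x 0 B = (Om x)^-1 * (div_xi G xi x 0 B + m%:R * z 0 B).
Proof.
refine (etrans (congr1 (fun v : 'rV[C]_N => v 0 B)
  (conformal_div_xi rG hxi n2m Om0 hOm)) _).
by rewrite mxE [X in _ * X]mxE [X in _ + X]mxE.
Qed.

Lemma condition_c_conformal : condition_c G xi m x <-> condition_c G' xi m x.
Proof.
(* The coefficient 2 / (m - 1) of (c) cancels the correction only if its denominator is nonzero. *)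
have m0 : m%:R - 1 != 0 :> C by rewrite subr_eq0 (eqr_nat C m 1) neq_ltn m1 orbT.
have transport := conformal_transport_low rG hxi xi0 pure_xi n2m Om0 hOm.
have cE a B D := condition_c_identity s0 m0
  (etrans (conformal_nabla_xi_xi rG hxi xi0 pure_xi n2m Om0 hOm a B D)
    (congr1 (fun t => t - _) (esym (nabla_xi_xiE rG hxi a B D))))
  (low_entry a B) (low_entry a D) (div_entry B) (div_entry D)
  (transport a B D) (transport a D B).
by split=> cc a B D; [exact (etrans (cE a B D) (cc a B D)) |
  exact (etrans (esym (cE a B D)) (cc a B D))].
Qed.

(** The powers of Om cancel in (nabla_a xi^b) xi_b, so [parallel_tensor] can be used with the
    unrescaled gamma matrices and the rescaled derivative of xi. *)
Lemma parallel_conformal : (N + N = 2 ^ m)%N -> parallel1 G' xi x <-> parallel2 G' xi x.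
Proof.
move=> dimN.
have par a := parallel_tensor (fun a => nabla_xi G xi a x - 2^-1 *: (z *m gamm G a x)) a
  (metric_sym (regular_met rG)) (metric_unit (regular_met rG)) (regular_clp rG)
  (regular_clm rG) n2m dimN xi0 pure_xi.
have nE a := conformal_nabla_xi G xi x Om a.
split=> P a B D.
  refine (etrans (congr1
    (fun v : 'rV[C]_N => 2^-1 * (v 0 B * xi x 0 D - v 0 D * xi x 0 B)) (nE a)) _).
  apply: (par a).1 => B' D'.
  exact (etrans (esym (conformal_nabla_tensor rG hxi Om0 hOm a B' D')) (P a B' D')).
refine (etrans (conformal_nabla_tensor rG hxi Om0 hOm a B D) _).
apply: (par a).2 => B' D'.
exact (etrans (esym (congr1
  (fun v : 'rV[C]_N => 2^-1 * (v 0 B' * xi x 0 D' - v 0 D' * xi x 0 B')) (nE a)))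
  (P a B' D')).
Qed.

Lemma condition_cf_parallel (f : 'rV[C]_n -> C) :
  (forall b, (Om x)^-1 * pd b Om x = pd b f x) ->
  condition_c G xi m x -> condition_f G xi m f x -> parallel1 G' xi x.
Proof.
move=> dOm /condition_c_conformal cc cf.
have zE B : z 0 B = \sum_b xi_up G xi b x 0 B * pd b f x.
  rewrite slash_mulmx_row mulmx_sumr summxE; apply: eq_bigr => b _.
  rewrite -scalemxAr mxE [log_gradient _ _ _ _]mxE mulrC dOm; congr (_ * _).
  exact (esym (congr1 (fun v : 'rV[C]_N => v 0 B) (xi_upE G xi x b))).
(* After rescaling, the condition on f loses its right-hand side. *)
have cf' A B := condition_f_identity s0 (div_entry B)
  (conformal_transport rG xi0 pure_xi n2m Om0 A B) (zE B) (cf A B).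
have rG' := conformal_regular rG Om0 hOm.
have tE' a B D : \sum_b xi_up G' xi b x 0 B * nabla_xi_low G' xi b a x 0 D =
    div_xi G' xi x 0 B * xi_low G' xi a x 0 D.
  apply: etrans _ (parallel_transport_slash (gamp G' a x) cf' B D).
  apply: eq_bigr => b _; congr (_ * _).
  exact (congr1 (fun v : 'rV[C]_N => v 0 D) (nabla_xi_lowE rG' hxi b a)).
by move=> a B D; exact (condition_c_vanishing (tE' a B D) (tE' a D B) (cc a B D)).
Qed.

End PointwiseConditions.

Section SpinManifold.
Variables (R : realType) (m : nat) (S : clifford_module R m).
Variables (X : spin_manifold S) (xi : projective_pure_spinor X).
Local Notation C := (CC R).

Lemma projective_pure_spinorP i x : cdom i x ->
  [/\ holo_mx (xi i) x, xi i x != 0 & pure_at (induced_geometry i) (xi i) m x].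
Proof. by case: xi => r r_holo r_neq0 r_pure *; split; auto. Qed.

Lemma conformally_invariantP (P : spin_geometry R (2 * m) (2 ^ m.-1) ->
    ('rV[C]_(2 * m) -> 'rV[C]_(2 ^ m.-1)) -> 'rV[C]_(2 * m) -> Prop) :
  (forall i x (Om : 'rV[C]_(2 * m) -> C), cdom i x -> (forall y, Om y != 0) -> holo Om x ->
    P (induced_geometry i) (xi i) x <-> P (conformal Om (induced_geometry i)) (xi i) x) ->
  conformally_invariant xi P.
Proof.
move=> inv Om [hOm Om0].
have inv_i i x : cdom i x -> P (induced_geometry i) (xi i) x <->
    P (conformal (Om \o param i) (induced_geometry i)) (xi i) x.
  move=> ix; apply: inv => //; [by move=> y; exact: Om0 | exact: hOm].
by split=> holdsP i x ix; apply/(inv_i i x ix); exact: holdsP.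
Qed.

End SpinManifold.

Theorem proposition5p10 (R : realType) (m : nat) (S : clifford_module R m)
    (X : spin_manifold S) (xi : projective_pure_spinor X) (hm : (2 < m)%N) :
  [/\ conformally_invariant xi (@condition_a _ _ _),
      conformally_invariant xi (@condition_b _ _ _),
      (3 < m)%N ->
        conformally_invariant xi
          (fun G z => condition_c G z m),
      (3 < m)%N ->
        holds xi (fun G z => condition_c G z m) ->
        forall f : X -> CC R, holo_on_manifold f -> holds_f xi f ->
        exists2 Om : X -> CC R, conformal_factor Om &
          holds_rescaled xi Om (@parallel1 _ _ _) /\
          holds_rescaled xi Om (@parallel2 _ _ _)
    & forall Om : X -> CC R, conformal_factor Om ->
        (holds_rescaled xi Om (@parallel1 _ _ _) <->
         holds_rescaled xi Om (@parallel2 _ _ _))].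
Proof.
have m1 : (1 < m)%N by exact: ltnW.
(* The two half-spin modules together have the dimension 2^m needed for m annihilation operators. *)
have dimS : (2 ^ m.-1 + 2 ^ m.-1 = 2 ^ m)%N.
  by rewrite addnn -mul2n -expnS prednK // ltnW.
have par_iff (Om : X -> CC R) : conformal_factor Om ->
    holds_rescaled xi Om (@parallel1 _ _ _) <-> holds_rescaled xi Om (@parallel2 _ _ _).
  move=> [hOm Om0]; split=> par i x ix; have [hxi xi0 pure] := projective_pure_spinorP xi ix;
    apply/(parallel_conformal (induced_regular ix) hxi xi0 pure (erefl _)
      (fun y => Om0 (param i y)) (hOm i x ix) dimS); exact: par.
split; last exact: par_iff.
- apply: conformally_invariantP => i x Om ix Om0 hOm.
  have [hxi xi0 pure] := projective_pure_spinorP xi ix.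
  exact (condition_a_conformal (induced_regular ix) hxi xi0 pure (erefl _) Om0 hOm).
- apply: conformally_invariantP => i x Om ix Om0 hOm.
  have [hxi xi0 pure] := projective_pure_spinorP xi ix.
  exact (condition_b_conformal (induced_regular ix) hxi xi0 pure (erefl _) Om0 hOm).
- move=> _; apply: conformally_invariantP => i x Om ix Om0 hOm.
  have [hxi xi0 pure] := projective_pure_spinorP xi ix.
  exact (condition_c_conformal (induced_regular ix) hxi xi0 pure (erefl _) m1 Om0 hOm).
- move=> _ cc f hf cf.
  have factor : conformal_factor (fun q => cexp (f q)).
    by split=> [i x ix | q]; [exact (holo_cexp (hf i x ix)) | exact: cexp_neq0].
  have par : holds_rescaled xi (fun q => cexp (f q)) (@parallel1 _ _ _).
    move=> i x ix; have [hxi xi0 pure] := projective_pure_spinorP xi ix.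
    apply (condition_cf_parallel (induced_regular ix) hxi xi0 pure (erefl _) m1
      (fun y => cexp_neq0 (f (param i y))) (holo_cexp (hf i x ix)) (f := f \o param i));
      [|exact: cc|exact: cf].
    (* For Omega = exp f the logarithmic gradient is df, as [condition_cf_parallel] requires. *)
    move=> b; refine (etrans (congr1 (fun t : CC R => _ * t) (pd_cexp b (hf i x ix))) _).
    exact: mulKf (cexp_neq0 _) _.
  by exists (fun q => cexp (f q)) => //; split=> //; apply/(par_iff _ factor).
Qed.
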